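(* Let $\beta\in(0,2)$, $\gamma\in(\beta,2]$, $\lambda\ge0$, $l>0$, $\Omega=(-l,l)\times(-l,l)$. Suppose $u\in C^2(\mathbb{R}^2)$ is the exact solution of the tempered fractional Poisson problem $$-(\Delta+\lambda)^{\frac{\beta}{2}}u=f\ \text{ in }\Omega,\qquad u=0\ \text{ in }\mathbb{R}^2\setminus\Omega.$$ Let $\mathbf{U}$ be the vector of values of $u$ at the interior grid points, and let $\mathbf{U}_h$ be the solution of the finite difference scheme $B\mathbf{U}_h=F$ with mesh size $h=2l/N$ (all defined in the context). Then there is a constant $C>0$ independent of $h$ such that $$\left\|\mathbf{U}-\mathbf{U}_h\right\|\leq C\,h^{2-\beta},\qquad \left\|\mathbf{U}-\mathbf{U}_h\right\|_{\infty}\leq C\,h^{2-\beta}.$$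
   Context: Tempered fractional Laplacian in two dimensions: $$(\Delta+\lambda)^{\frac{\beta}{2}}u(\mathbf{x})=-c_{2,\beta,\lambda}\,\mathrm{P.V.}\int_{\mathbb{R}^2}\frac{u(\mathbf{x})-u(\mathbf{y})}{e^{\lambda|\mathbf{x}-\mathbf{y}|}|\mathbf{x}-\mathbf{y}|^{2+\beta}}\,d\mathbf{y},$$ where $c_{2,\beta,\lambda}>0$ is a normalization constant depending only on $\beta,\lambda$: for $\lambda>0$, $\beta\ne1$, $c_{2,\beta,\lambda}=\frac{1}{2\pi|\Gamma(-\beta)|}$, and for $\lambda=0$ (fractional Laplacian) it is $c_{2,\beta}=\frac{\beta\,\Gamma(1+\beta/2)}{2^{1-\beta}\pi\,\Gamma(1-\beta/2)}$. Scheme. Let $L=2l$, $N\ge2$ an integer, $h=L/N$, $\xi_i=ih$, $\eta_j=jh$, $r_{i,j}=\sqrt{\xi_i^2+\eta_j^2}$. Let $k_\gamma=1$ if $\gamma\in(\beta,2)$, $k_\gamma=\frac43$ if $\gamma=2$, and $$G_{0,0}=\int_0^h\int_0^h(\xi^2+\eta^2)^{\frac{\gamma-2-\beta}{2}}\,d\eta\,d\xi,\qquad G^\infty=\iint_{[0,\infty)^2\setminus[0,L]^2}\frac{d\eta\,d\xi}{e^{\lambda\sqrt{\xi^2+\eta^2}}\left(\sqrt{\xi^2+\eta^2}\right)^{2+\beta}}.$$ With the hat functions $\Lambda_i(s)=\max(0,1-|s-ih|/h)$, define for $0\le i,j\le N$, $(i,j)\ne(0,0)$, $$\kappa_{i,j}=\iint_{[0,L]^2\setminus[0,h]^2}\Lambda_i(\xi)\Lambda_j(\eta)(\xi^2+\eta^2)^{\frac{\gamma-2-\beta}{2}}\,d\eta\,d\xi+\epsilon_{i,j}\frac{k_\gamma}{4}G_{0,0},$$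 where $\epsilon_{i,j}=1$ if $(i,j)\in\{(1,0),(0,1),(1,1)\}$ and $\epsilon_{i,j}=0$ otherwise. (These are the coefficients of the nodal values obtained from the weighted trapezoidal rule on the cell $[0,h]^2$ and bilinear interpolation on all other cells of $[0,L]^2$.) The weights are $$w_{i,j}=-c_{2,\beta,\lambda}\,m_{i,j}\,\frac{\kappa_{i,j}}{e^{\lambda r_{i,j}}r_{i,j}^{\gamma}}\quad\text{for }(i,j)\ne(0,0),\qquad w_{0,0}=4c_{2,\beta,\lambda}\left(\sum_{\substack{0\le i,j\le N\\(i,j)\ne(0,0)}}\frac{\kappa_{i,j}}{e^{\lambda r_{i,j}}r_{i,j}^{\gamma}}+G^\infty\right),$$ with $m_{i,j}=2$ if exactly one of $i,j$ is $0$ and $m_{i,j}=1$ if $i,j\ge1$. $B$ is the $(N-1)^2\times(N-1)^2$ matrix indexed by pairs $(p,q),(p',q')\in\{1,\dots,N-1\}^2$ with entries $B_{(p,q),(p',q')}=w_{|p-p'|,|q-q'|}$. $\mathbf{U}=(u(-l+ph,-l+qh))_{1\le p,q\le N-1}$, $F=(f(-l+ph,-l+qh))_{1\le p,q\le N-1}$, and $\mathbf{U}_h$ solves $B\mathbf{U}_h=F$. Discrete norms for $\mathbf{V}=(v_i)_{i=1}^{M}\in\mathbb{R}^{M}$ with $M=(N-1)^2$: $\|\mathbf{V}\|=\big(h^2\sum_{i=1}^M v_i^2\big)^{1/2}$ and $\|\mathbf{V}\|_\infty=\max_{1\le i\le M}|v_i|$. *)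

(* Defs.v *)
From mathcomp Require Import all_boot all_order all_algebra.
From mathcomp Require Import all_classical all_reals all_analysis.

Set Implicit Arguments.
Unset Strict Implicit.
Unset Printing Implicit Defensive.
Import Order.TTheory GRing.Theory Num.Theory.
Import numFieldNormedType.Exports.
Local Open Scope classical_set_scope.
Local Open Scope ring_scope.

(* Euler's integral, meaningful for x > 0. *)
Definition gamma_integral (R : realType) (x : R) : R :=
  \int[@lebesgue_measure R]_(t in `]0, +oo[) (t `^ (x - 1) * expR (- t)).

(* Gamma x = Gamma (x + n) / (x (x + 1) ... (x + n - 1)), with n > |x| so that
   the integral is taken at a positive argument; poles get a junk value. *)
Definition Gamma (R : realType) (x : R) : R :=
  let n := (Num.truncn `|x|).+1 in
  gamma_integral (x + n%:R) / \prod_(k < n) (x + k%:R).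

(* No closed form is prescribed when lambda > 0 and beta = 1: the constant is
   then only required to be positive. *)
Definition is_normalization_constant (R : realType) (beta lambda c : R) : Prop :=
  [/\ 0 < c,
      0 < lambda -> beta != 1 -> c = (2 * pi * `|Gamma (- beta)|)^-1 &
      lambda = 0 ->
        c = beta * Gamma (1 + beta / 2) /
            (2 `^ (1 - beta) * pi * Gamma (1 - beta / 2))].

Notation lebesgue2 R :=
  (@lebesgue_measure R \x @lebesgue_measure R)%E (only parsing).

(* The library norm on R * R is the max norm. *)
Definition euclid (R : realType) (x : R * R) : R :=
  Num.sqrt (x.1 ^+ 2 + x.2 ^+ 2).

Definition has_continuous_partials (R : realType) (g : R * R -> R) : Prop :=
  forall v : R * R, v = (1, 0) \/ v = (0, 1) ->
    (forall x, derivable g x v) /\ continuous ('D_v g).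

Definition C2 (R : realType) (u : R * R -> R) : Prop :=
  [/\ continuous u, has_continuous_partials u,
      has_continuous_partials ('D_((1, 0) : R * R) u) &
      has_continuous_partials ('D_((0, 1) : R * R) u)].

Definition truncated_integral (R : realType) (beta lambda : R)
    (u : R * R -> R) (x : R * R) (eps : R) : R :=
  \int[lebesgue2 R]_(y in [set y : R * R | eps < euclid (x - y)])
    ((u x - u y) /
     (expR (lambda * euclid (x - y)) * euclid (x - y) `^ (2 + beta))).

Definition tempered_laplacian (R : realType) (beta lambda c : R)
    (u : R * R -> R) (x : R * R) : R :=
  - c * lim (truncated_integral beta lambda u x @ 0^'+).

Definition Omega (R : realType) (l : R) : set (R * R) :=
  `]- l, l[ `*` `]- l, l[.

Definition solves_tempered_poisson (R : realType) (beta lambda c l : R)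
    (u f : R * R -> R) : Prop :=
  (forall x, Omega l x ->
     cvg (truncated_integral beta lambda u x @ 0^'+) /\
     - tempered_laplacian beta lambda c u x = f x) /\
  (forall x, ~ Omega l x -> u x = 0).

Definition mesh (R : realType) (l : R) (N : nat) : R := 2 * l / N%:R.

Definition square (R : realType) (a : R) : set (R * R) :=
  `[0, a] `*` `[0, a].

Definition k_gamma (R : realType) (gamma : R) : R :=
  if gamma == 2 then 4 / 3 else 1.

Definition G00 (R : realType) (beta gamma h : R) : R :=
  \int[lebesgue2 R]_(z in square h)
    ((z.1 ^+ 2 + z.2 ^+ 2) `^ ((gamma - 2 - beta) / 2)).

Definition Ginf (R : realType) (beta lambda l : R) : R :=
  \int[lebesgue2 R]_(z in (`[0, +oo[ `*` `[0, +oo[) `\` square (2 * l))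
    (expR (lambda * euclid z) * euclid z `^ (2 + beta))^-1.

Definition hat (R : realType) (h : R) (i : nat) (s : R) : R :=
  Num.max 0 (1 - `|s - i%:R * h| / h).

Definition kappa (R : realType) (beta gamma l : R) (N i j : nat) : R :=
  let h := mesh l N in
  \int[lebesgue2 R]_(z in square (2 * l) `\` square h)
    (hat h i z.1 * hat h j z.2 *
     (z.1 ^+ 2 + z.2 ^+ 2) `^ ((gamma - 2 - beta) / 2))
  + ((i, j) \in [:: (1, 0); (0, 1); (1, 1)]%N)%:R
    * (k_gamma gamma / 4) * G00 beta gamma h.

Definition scaled_kappa (R : realType) (beta gamma lambda l : R)
    (N i j : nat) : R :=
  let r := euclid (i%:R * mesh l N, j%:R * mesh l N) in
  kappa beta gamma l N i j / (expR (lambda * r) * r `^ gamma).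

Definition weight (R : realType) (beta gamma lambda c l : R)
    (N i j : nat) : R :=
  if (i == 0%N) && (j == 0%N) then
    4 * c * (\sum_(a < N.+1) \sum_(b < N.+1 | (a != 0%N :> nat) || (b != 0%N :> nat))
               scaled_kappa beta gamma lambda l N a b
             + Ginf beta lambda l)
  else
    - c * (if (i == 0%N) || (j == 0%N) then 2 else 1)
    * scaled_kappa beta gamma lambda l N i j.

(* Row-major numbering of {1, ..., N-1}^2 by 'I_((N-1)^2). *)
Definition grid_index (N : nat) (a : 'I_(N.-1 ^ 2)) : nat * nat :=
  ((a %/ N.-1).+1, (a %% N.-1).+1)%N.

Definition scheme_matrix (R : realType) (beta gamma lambda c l : R) (N : nat) :
    'M[R]_(N.-1 ^ 2) :=
  \matrix_(a, b) weight beta gamma lambda c l N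
    `|(grid_index a).1 - (grid_index b).1|%N
    `|(grid_index a).2 - (grid_index b).2|%N.

Definition grid_values (R : realType) (l : R) (N : nat) (g : R * R -> R) :
    'cV[R]_(N.-1 ^ 2) :=
  \col_a g (- l + (grid_index a).1%:R * mesh l N,
            - l + (grid_index a).2%:R * mesh l N).

Definition norm2h (R : realType) (h : R) (M : nat) (V : 'cV[R]_M) : R :=
  Num.sqrt (h ^+ 2 * \sum_(i < M) V i ord0 ^+ 2).

Definition norm_inf (R : realType) (M : nat) (V : 'cV[R]_M) : R :=
  \big[Num.max/0]_(i < M) `|V i ord0|.

(* Main.v *)
(* The residual of the scheme at a grid point is bounded by h^(2-beta), and the
   matrix is strictly diagonally dominant with margin 4 c Ginf > 0, which does
   not depend on h; the maximum principle then turns the residual bound into an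
   error bound in the maximum norm, hence in the discrete L2 norm.

   For the residual, reflecting the four quadrants onto one turns the truncated
   singular integral at x into the integral of sym_diff u x z * K(|z|) over the
   quadrant, where sym_diff u x z = O(|z|^2) collects four values of
   u(x) - u(x +- z). Beyond [0, 2l]^2 it equals 4 u(x) Ginf, exactly as in the
   scheme. On [0, h]^2 the integral and its quadrature are both O(h^(2-beta)).
   In between, the function psi z = sym_diff u x z * e^(-lambda |z|) |z|^-gamma
   has bilinear interpolation error O(h^2 |z|^-gamma), since its pure second
   derivatives are of that order, and the integral of
   h^2 |z|^-gamma |z|^(gamma-2-beta) outside [0, h]^2 is O(h^(2-beta)). *)
Require Import Defs.
From mathcomp Require Import all_boot all_order all_algebra.
From mathcomp Require Import all_classical all_reals all_analysis.
From mathcomp Require Import measurable_realfun zify ring lra.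
Import Order.TTheory GRing.Theory Num.Theory.
Import numFieldNormedType.Exports.
Local Open Scope classical_set_scope.
Local Open Scope ring_scope.

(* [lebesgue_measure] lives on [measurableTypeR R], whose measurable structure
   carries another display than the canonical one of [R]. *)
Local Notation plane R := (measurableTypeR R * measurableTypeR R)%type.

(** * Measurability and symmetries of the plane *)

(** Smoothness of [u] enters only along horizontal and vertical lines, where [u] is C^{1,1} with one
    global constant. Bilinear interpolation is therefore done one coordinate at a time, and neither
    mixed derivatives nor a multivariate Taylor formula occur. The order h^2 |z|^-gamma rests on an
    exact balance: each derivative falling on e^(-lambda |z|) |z|^-gamma costs a factor 1/|z|, while
    [sym_diff] is O(|z|^2) and has Lipschitz constant O(|z|), so that every lost power of |z| is
    regained. For this, |z| must be comparable to a single radius on each cell. That holds as soon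
    as the corner nearest to the origin is at distance at least h, which is true of every cell other
    than [0, h]^2. The consistency estimate is proved for the truncated integrals, uniformly in the
    truncation radius below h. Existence of the principal value is part of being a solution, so only
    an inequality has to pass to the limit. *)

Lemma open_measurable_prod {R : realType} (A : set (R * R)) :
  open A -> measurable (A : set (plane R)).
Proof.
move=> oA.
(* Rational balls of radius [1 / (n + 1)], those not contained in [A] being replaced by the empty
   set, so that the union runs over a whole countable type. Balls of the max norm are products of
   intervals, hence measurable. *)
pose F (q : rat * rat * nat) : set (R * R) :=
  [set z | ball (ratr q.1.1 : R, ratr q.1.2 : R) (q.2.+1%:R^-1) `<=` A /\
           ball (ratr q.1.1 : R, ratr q.1.2 : R) (q.2.+1%:R^-1) z].
have -> : A = \bigcup_q F q.
  apply/seteqP; split=> [z Az|z [q _ [+ zq]]]; last exact.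
  have /nbhs_ballP[e /= e0 eA] := open_nbhs_nbhs (conj oA Az).
  have [n ne] : exists n : nat, (n.+1%:R^-1 : R) < e / 2.
    have e2 : 0 < (2 / e : R) by rewrite divr_gt0.
    exists (Num.truncn (2 / e)).
    rewrite -(invf_div 2 e) ltf_pV2 ?posrE//.
    by rewrite truncnS_gt.
  have rb (x : R) : exists q : rat, ball x (n.+1%:R^-1) (ratr q).
    have /(_ (ball x (n.+1%:R^-1))) := @dense_rat R.
    case.
    - by exists x; exact: ballxx.
    - exact: ball_open.
    - by move=> y [? [q _ qy]]; exists q; rewrite qy.
  have [q1 h1] := rb z.1; have [q2 h2] := rb z.2.
  exists (q1, q2, n) => //; split => /=.
    apply: subset_trans eA => w wq.
    rewrite (splitr e).
    apply: (@ball_triangle _ _ (ratr q1 : R, ratr q2 : R)).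
      by apply: (le_ball (ltW ne)); split.
    by apply: (le_ball (ltW ne)).
  by split => /=; exact: ball_sym.
apply: countable_bigcupT_measurable => [|q]; first exact: countableP.
rewrite /F; have [?|nb] := pselect (ball (ratr q.1.1 : R,
  ratr q.1.2 : R) (q.2.+1%:R^-1) `<=` A).
  rewrite (_ : mkset _ = ball (ratr q.1.1 : R) (q.2.+1%:R^-1) `*` ball (ratr
    q.1.2 : R) (q.2.+1%:R^-1)).
    by apply: measurableX; rewrite ball_itv; exact: measurable_itv.
  by apply/seteqP; split => [z [_ [? ?]]|z [? ?]] //; split.
rewrite (_ : mkset _ = set0)//; apply/seteqP; split => z // [] //.
Qed.

Lemma continuous_measurable_prod {R : realType} (f : R * R -> R) :
  continuous f -> measurable_fun setT (f : plane R -> R).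
Proof.
move=> /continuousP cf; apply: (measurability _ (RGenOpens.measurableE R)).
move=> _ [_ [a [b ->] <-]]; rewrite setTI; apply: open_measurable_prod.
exact/cf/interval_open.
Qed.

(** The sign is a boolean so that translations and reflections share one change of variables. *)
Definition reflect1 {R : realType} (s : bool) (a : R) (x : measurableTypeR R) :
  measurableTypeR R :=
  a + (-1) ^+ s * x.

Lemma measurable_reflect1 {R : realType} (s : bool) (a : R) :
  measurable_fun setT (reflect1 s a).
Proof.
by apply: measurable_funD => //; apply: measurable_funM.
Qed.

Lemma lebesgue_reflect1 {R : realType} (s : bool) (a : R) (A : set R) :
  measurable A ->
  pushforward lebesgue_measure (reflect1 s a) A =
  lebesgue_measure A.
Proof.
move=> mA; apply/esym/lebesgue_measure_unique => //=.
  exact: measurable_reflect1.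
move=> _ _ [[x y] /= xy <-].
rewrite /= /pushforward.
case: s.
  (* Reflection turns the generators []x, y]] into intervals closed on the left, of the same
     length. *)
  rewrite (_ : _ @^-1` _ = `[a - y, a - x[%classic).
    rewrite !lebesgue_measure_itv /= !lte_fin ltrD2l ltrN2.
    by case: ifP => // _; rewrite -!EFinB; congr EFin; rewrite /=; lra.
  by apply/seteqP; split => z /=; rewrite !in_itv /= /reflect1 expr1; lra.
rewrite (_ : _ @^-1` _ = `]x - a, y - a]%classic).
  rewrite !lebesgue_measure_itv /= !lte_fin ltrD2r.
  by case: ifP => // _; rewrite -!EFinB; congr EFin; rewrite /=; lra.
by apply/seteqP; split => z /=; rewrite !in_itv /= /reflect1 expr0; lra.
Qed.

Definition reflect2 {R : realType} (s t : bool) (x z : plane R) : plane R :=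
  (reflect1 s x.1 z.1, reflect1 t x.2 z.2).

Lemma measurable_reflect2 {R : realType} (s t : bool) (x : plane R) :
  measurable_fun setT (reflect2 s t x).
Proof.
apply/measurable_fun_pairP; split => /=.
  exact: (measurableT_comp (measurable_reflect1 s x.1)).
exact: (measurableT_comp (measurable_reflect1 t x.2)).
Qed.

Lemma lebesgue_reflect2 {R : realType} (s t : bool) (x : plane R) (A :
  set (plane R)) :
  measurable A ->
  pushforward (lebesgue2 R) (reflect2 s t x) A =
  lebesgue2 R A.
Proof.
move=> mA; apply/esym/product_measure_unique => //=.
  exact: measurable_reflect2.
move=> _ B C mB mC; rewrite /pushforward.
rewrite (_ : _ @^-1` _ = (reflect1 s x.1 @^-1` B) `*` (reflect1 t x.2 @^-1` C))
  //.
rewrite product_measure1E; last 2 first.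
- by rewrite -[X in measurable X]setTI; exact: measurable_reflect1.
- by rewrite -[X in measurable X]setTI; exact: measurable_reflect1.
by congr (_ * _)%E; exact: lebesgue_reflect1.
Qed.

Lemma integral_reflect2 {R : realType} (s t : bool) (x : plane R)
    (D : set (plane R)) (f : plane R -> R) :
  measurable D -> measurable_fun setT f ->
  (lebesgue2 R).-integrable (reflect2 s t x @^-1` D) (EFin \o (f \o reflect2 s t
    x)) ->
  (lebesgue2 R).-integrable D (EFin \o f) /\
  \int[lebesgue2 R]_(y in D) f y =
  \int[lebesgue2 R]_(z in reflect2 s t x @^-1` D) f (reflect2 s t x z).
Proof.
move=> mD mf intf.
have mF : measurable_fun setT (EFin \o f) by exact/measurable_EFinP.
have := integrable_pushforward (measurable_reflect2 s t x) mF intf mD.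
have E (g : plane R -> \bar R) : (\int[pushforward (lebesgue2 R) (reflect2 s t
  x)]_(y in D) g y = \int[lebesgue2 R]_(y in D) g y)%E.
  apply: eq_measure_integral => [|mphi A mA _];
    first exact: measurable_reflect2.
  exact: lebesgue_reflect2.
move=> /integrableP[mfD foo]; split.
  apply/integrableP; split; first exact: mfD.
  by rewrite -(E (fun y => `|(EFin \o f) y|)%E); exact: foo.
rewrite /Rintegral -(E (fun y => (f y)%:E)).
by rewrite (integral_pushforward (measurable_reflect2 s t x) mF intf mD).
Qed.

Lemma eq_Rintegral_null {d} {T : measurableType d} {R : realType}
    (mu : {measure set T -> \bar R}) (A B : set T) (f : T -> R) :
  measurable A -> measurable B -> B `<=` A -> mu (A `\` B) = 0%E ->
  mu.-integrable A (EFin \o f) ->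
  \int[mu]_(x in A) f x = \int[mu]_(x in B) f x.
Proof.
move=> mA mB BA AB0 intf; congr fine.
rewrite (@negligible_integral _ _ _ _ A (A `\` B)) //; last exact: measurableD.
by rewrite setDD setIC; congr (integral _ _ _); apply/setIidPl.
Qed.

(** The part of [D] outside [H] is reflected into [H], where it misses only a null set. In the
    applications [H] is a closed half-plane and the null set is its boundary axis; two such foldings
    lead from the plane to the closed quadrant. *)
Lemma integral_fold {R : realType} (s t : bool) (D H : set (plane R)) (F :
  plane R -> R) :
  let sigma := reflect2 s t (0, 0) in
  measurable D -> measurable H -> measurable_fun setT F ->
  sigma @^-1` D = D -> sigma @^-1` (~` H) `<=` H ->
  lebesgue2 R (H `\` sigma @^-1` (~` H)) = 0%E ->
  (lebesgue2 R).-integrable D (EFin \o F) ->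
  (lebesgue2 R).-integrable (D `&` H) (EFin \o (fun z => F z + F (sigma z))) /\
  \int[lebesgue2 R]_(z in D) F z =
  \int[lebesgue2 R]_(z in D `&` H) (F z + F (sigma z)).
Proof.
move=> sigma mD mH mF sD sH N0 intF.
have ss z : sigma (sigma z) = z.
  by case: z => a b; rewrite /sigma /reflect2 /reflect1 /= !add0r !signrMK.
have ms : measurable_fun setT sigma by exact: measurable_reflect2.
have mFs : measurable_fun setT (F \o sigma) by exact: measurableT_comp.
have msi A : measurable A -> measurable (sigma @^-1` A).
  by move=> mA; rewrite -[X in measurable X]setTI; exact: ms.
have intFs : (lebesgue2 R).-integrable D (EFin \o (F \o sigma)).
  have [] // := @integral_reflect2 R s t (0, 0) D (F \o sigma) mD mFs.
  rewrite -/sigma sD; apply: eq_integrable intF => // z _ /=.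
  by rewrite ss.
have mDH : measurable (D `&` H) by exact: measurableI.
have i1 : (lebesgue2 R).-integrable (D `&` H) (EFin \o F).
  exact: integrableS intF.
have i2 : (lebesgue2 R).-integrable (D `&` H) (EFin \o (F \o sigma)).
  exact: integrableS intFs.
split; first by have := integrableD mDH i1 i2.
rewrite RintegralD// -{1}(setUIDK D H) Rintegral_setU//; last 3 first.
- exact: measurableD.
- by rewrite setUIDK.
- by apply/disj_setPS => z [[_ ?] []].
congr (_ + _).
have mHc := measurableC mH.
have mDc : measurable (D `&` sigma @^-1` (~` H)).
  by apply: measurableI => //; exact: msi.
have [|_ ->] := @integral_reflect2 R s t (0, 0) (D `\` H) F (measurableD mD mH)
  mF.
  rewrite -/sigma setDE preimage_setI sD.
  exact: integrableS intFs.
rewrite -/sigma setDE preimage_setI sD.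
apply/esym/eq_Rintegral_null => //.
- by apply: setIS.
- apply: subset_measure0 N0.
  + by apply: measurableD.
  + by apply: measurableD => //; exact: msi.
  + by move=> z [[Dz Hz] nz]; split => // sz; apply: nz.
Qed.

(** * Integrals of powers of the Euclidean norm *)

Lemma euclid_sqr {R : realType} (z : R * R) : euclid z ^+ 2 = z.1 ^+ 2 + z.2 ^+
  2.
Proof. by rewrite sqr_sqrtr ?addr_ge0 ?sqr_ge0. Qed.

Lemma euclid_ge0 {R : realType} (z : R * R) : 0 <= euclid z.
Proof. exact: sqrtr_ge0. Qed.

Lemma euclid_mono {R : realType} (p q p' q' : R) :
  0 <= p -> 0 <= q -> p <= p' -> q <= q' -> euclid (p, q) <= euclid (p', q').
Proof.
move=> p0 q0 pp qq; rewrite -(@ler_pXn2r _ 2) ?nnegrE ?euclid_ge0//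
  !euclid_sqr /=.
have p'0 := le_trans p0 pp; have q'0 := le_trans q0 qq.
by apply: lerD; rewrite ler_pXn2r ?nnegrE.
Qed.

Lemma euclid_swap {R : realType} (p q : R) : euclid (p, q) = euclid (q, p).
Proof. by rewrite /euclid /= addrC. Qed.

Lemma measurable_euclid {R : realType} :
  measurable_fun setT (@euclid R : plane R -> R).
Proof.
have ms : measurable_fun setT (@Num.sqrt R).
  exact: continuous_measurable_fun (@sqrt_continuous R).
apply: (measurableT_comp ms).
apply: measurable_funD; apply: measurable_funX.
  exact: measurable_fst.
exact: measurable_snd.
Qed.

Lemma measurable_euclid_powR {R : realType} (p : R) :
  measurable_fun setT (fun z : plane R => euclid z `^ p).
Proof.
exact: (measurableT_comp (measurable_powR p) measurable_euclid).
Qed.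

(** The exponent [|p|] on [K] lets one bound serve both signs of [p]. *)
Lemma powR_comparable {R : realType} (p a K x : R) :
  0 < a -> 1 <= K -> a <= x <= K * a -> x `^ p <= K `^ `|p| * a `^ p.
Proof.
move=> a0 K1 /andP[ax xK].
have -> : x = x / a * a by rewrite divfK ?gt_eqF.
have xa1 : 1 <= x / a by rewrite ler_pdivlMr// mul1r.
rewrite powRM ?(ltW a0) ?(le_trans _ xa1)// ler_wpM2r ?powR_ge0//.
apply: (@le_trans _ _ ((x / a) `^ `|p|)); first exact: ler_powR (ler_norm p).
apply: ge0_ler_powR; rewrite ?nnegrE//.
- exact: le_trans xa1.
- exact: le_trans K1.
- by rewrite ler_pdivrMr.
Qed.

(** Dyadic shells are taken in the max norm: its balls are products of intervals, so their measure
    is explicit, and it agrees with [euclid] up to a factor 2. *)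
Definition sup_norm {R : realType} (z : plane R) : R := Num.max `|z.1| `|z.2|.

Lemma measurable_sup_norm {R : realType} : measurable_fun setT (@sup_norm R).
Proof.
by apply: measurable_maxr; apply: measurableT_comp.
Qed.

Lemma measurable_sup_gt {R : realType} (t : R) :
  measurable [set z : plane R | t < sup_norm z].
Proof.
rewrite (_ : mkset _ = sup_norm @^-1` `]t, +oo[).
  by rewrite -[X in measurable X]setTI; exact: measurable_sup_norm.
by apply/seteqP; split => z /=; rewrite in_itv /= andbT.
Qed.

Lemma measurable_sup_le {R : realType} (t : R) :
  measurable [set z : plane R | sup_norm z <= t].
Proof.
rewrite (_ : mkset _ = ~` [set z | t < sup_norm z]).
  by apply: measurableC; exact: measurable_sup_gt.
by apply/seteqP; split => z /=; [move=> ?; apply/negP; rewrite -leNgt|move/negP;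
  rewrite -leNgt].
Qed.

Lemma sup_norm_ge0 {R : realType} (z : plane R) : 0 <= sup_norm z.
Proof. by rewrite /sup_norm le_max normr_ge0. Qed.

Lemma sup_norm_euclid {R : realType} (z : plane R) :
  sup_norm z <= euclid z <= 2 * sup_norm z.
Proof.
have m0 := sup_norm_ge0 z.
have h1 : `|z.1| <= sup_norm z by rewrite /sup_norm le_max lexx.
have h2 : `|z.2| <= sup_norm z by rewrite /sup_norm le_max lexx orbT.
have n1 := normr_ge0 z.1; have n2 := normr_ge0 z.2.
have e0 : 0 <= euclid z by exact: sqrtr_ge0.
have e2 : euclid z ^+ 2 = `|z.1| ^+ 2 + `|z.2| ^+ 2.
  by rewrite sqr_sqrtr ?addr_ge0 ?sqr_ge0// !real_normK ?num_real.
apply/andP; split.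
  rewrite -(@ler_pXn2r _ 2) ?nnegrE// e2 /sup_norm.
  by case: (leP `|z.1| `|z.2|) => _; nra.
rewrite -(@ler_pXn2r _ 2) ?nnegrE ?mulr_ge0// e2; nra.
Qed.

Definition annulus {R : realType} (a : R) : set (plane R) :=
  [set z | a < sup_norm z <= 2 * a].

Lemma measurable_annulus {R : realType} (a : R) : measurable (annulus a).
Proof.
rewrite (_ : annulus a = sup_norm @^-1` `]a, 2 * a]).
  by rewrite -[X in measurable X]setTI; exact: measurable_sup_norm.
by apply/seteqP; split => z /=; rewrite in_itv.
Qed.

Lemma measure_annulus {R : realType} (a : R) : 0 < a ->
  (lebesgue2 R (annulus a) <= (16 * a ^+ 2)%:E)%E.
Proof.
move=> a0; apply: (@le_trans _ _ (lebesgue2 R (`[- (2 * a),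
  2 * a] `*` `[- (2 * a), 2 * a]))).
  apply: le_measure; rewrite ?inE.
  - exact: measurable_annulus.
  - by apply: measurableX; exact: measurable_itv.
  - move=> z /andP[_]; rewrite /sup_norm ge_max !ler_norml => /andP[z1 z2].
    by split; rewrite /= in_itv.
rewrite product_measure1E; [|exact: measurable_itv..].
rewrite [X in (X * X)%E](_ : _ = (4 * a)%:E).
  by rewrite -EFinM lee_fin; nra.
transitivity (@lebesgue_measure R `[- (2 * a), 2 * a]); first by [].
rewrite lebesgue_measure_itv /= lte_fin ifT; last by lra.
by congr EFin; rewrite /=; lra.
Qed.

(** The Euclidean norm lies between [a] and [4 * a] on the shell, hence [4 ^ |p|]; the factor 16
    comes from the area of the enclosing square of side [4 * a]. *)
Lemma integral_annulus {R : realType} (p a : R) : 0 < a ->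
  (\int[lebesgue2 R]_(z in annulus a) (euclid z `^ p)%:E <=
   (16 * 4 `^ `|p| * a `^ (p + 2))%:E)%E.
Proof.
move=> a0; apply: (@le_trans _ _ (\int[lebesgue2 R]_(z in annulus a) cst (4 `^
  `|p| * a `^ p)%:E z)%E).
  apply: ge0_le_integral.
  - exact: measurable_annulus.
  - by move=> z _; rewrite lee_fin powR_ge0.
  - apply/measurable_EFinP; apply: measurable_funTS;
    exact: measurable_euclid_powR.
  - exact: measurable_cst.
  - move=> z /andP[az za]; rewrite lee_fin; apply: powR_comparable;
    [by []|by lra|].
    have /andP[h1 h2] := sup_norm_euclid z. apply/andP; split; lra.
rewrite integral_cst; last exact: measurable_annulus.
apply: (@le_trans _ _ ((4 `^ `|p| * a `^ p)%:E * (16 * a ^+ 2)%:E)%E).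
  apply: lee_pmul => //; last exact: measure_annulus.
  by rewrite lee_fin mulr_ge0 ?powR_ge0.
rewrite -EFinM lee_fin (_ : (_ : R) `^ (p + 2) = a `^ p * a ^+ 2).
  by rewrite le_eqVlt; apply/orP; left; apply/eqP; ring.
by rewrite powRD ?(gt_eqF a0) ?implybT// powR_mulrn// ltW.
Qed.

(* Covers both the dilations [r = 2] (decay at infinity, p < -2) and the
   contractions [r = 1/2] (singularity at 0, p > -2). *)
Lemma integral_annuli {R : realType} (p a r : R) : 0 < a -> 0 < r ->
  r `^ (p + 2) < 1 -> trivIset setT (fun k => annulus (a * r ^+ k)) ->
  (\int[lebesgue2 R]_(z in \bigcup_k annulus (a * r ^+ k)) (euclid z `^ p)%:E <=
   (16 * 4 `^ `|p| * a `^ (p + 2) / (1 - r `^ (p + 2)))%:E)%E.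
Proof.
move=> a0 r0 q1 triv; rewrite ge0_integral_bigcup; first last.
- exact: triv.
- by move=> z _; rewrite lee_fin powR_ge0.
- apply/measurable_EFinP; apply: measurable_funTS;
  exact: measurable_euclid_powR.
- by move=> k; exact: measurable_annulus.
set q := r `^ (p + 2) in q1 *; set c := 16 * 4 `^ `|p| * a `^ (p + 2).
have q0 : 0 <= q by exact: powR_ge0.
have c0 : 0 <= c by rewrite !mulr_ge0 ?powR_ge0.
apply: (@le_trans _ _ (\sum_(0 <= k <oo) (geometric c q k)%:E)%E).
  apply: lee_nneseries => k _.
    by move=> _; apply: integral_ge0 => z _; rewrite lee_fin powR_ge0.
  have ak : 0 < a * r ^+ k by rewrite mulr_gt0 ?exprn_gt0.
  apply: (le_trans (integral_annulus p _ ak)).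
  rewrite lee_fin /geometric /= /c powRM ?(ltW a0) ?exprn_ge0 ?(ltW r0)//
    -mulrA.
  rewrite !mulrA le_eqVlt; apply/orP; left; apply/eqP; congr (_ * _).
  rewrite /q -(powR_mulrn _ (ltW r0)) -(powR_mulrn _ (powR_ge0 _ _)).
  by rewrite -!powRrM mulrC.
have cg : `|q| < 1 by rewrite ger0_norm.
rewrite le_eqVlt; apply/orP; left; apply/eqP.
apply/cvg_lim => //.
have -> : (fun n => (\sum_(0 <= k < n) (geometric c q k)%:E)%E) = EFin \o series
  (geometric c q).
  by apply/funext => n; rewrite /= /series /= sumEFin.
apply: cvg_EFin; last exact: (@cvg_geometric_series _ c q cg).
by apply: nearW.
Qed.

Lemma trivIset_annulus {R : realType} (a : nat -> R) :
  (forall i j, (i < j)%N -> 2 * a i <= a j \/ 2 * a j <= a i) ->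
  trivIset setT (fun k => annulus (a k)).
Proof.
move=> h; apply/trivIsetP => i j _ _.
wlog ij : i j / (i < j)%N => [H|_].
  by rewrite neq_ltn => /orP[ij|ji]; [|rewrite setIC]; apply: H => //;
    rewrite neq_ltn ?ij ?ji.
apply/seteqP; split => // z [/andP[h1 h2] /andP[h3 h4]].
by case: (h _ _ ij) => h5; lra.
Qed.

Lemma powR_lt1 {R : realType} (a x : R) : 1 < a -> x < 0 -> a `^ x < 1.
Proof.
move=> a1 x0; rewrite /powR gt_eqF ?(lt_trans _ a1)// expR_lt1.
by rewrite nmulr_rlt0// ln_gt0.
Qed.

Lemma integral_euclid_outer {R : realType} (p t : R) : p + 2 < 0 -> 0 < t ->
  (\int[lebesgue2 R]_(z in [set z | (t < sup_norm z)%R]) (euclid z `^ p)%:E <=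
   (16 * 4 `^ `|p| / (1 - 2 `^ (p + 2)) * t `^ (p + 2))%:E)%E.
Proof.
move=> p2 t0.
have q1 : (2 : R) `^ (p + 2) < 1.
  by apply: powR_lt1 => //; rewrite ltr1n.
have := @integral_annuli R p t 2 t0 (ltr0Sn _ _) q1.
rewrite (_ : \bigcup_k _ = [set z | t < sup_norm z]); last first.
  apply/seteqP; split => z /=.
    move=> [k _] /andP[+ _]; apply: le_lt_trans.
    by rewrite ler_peMr ?(ltW t0)// exprn_ege1// ler1n.
  move=> tz.
  have [n zn] : exists n, sup_norm z <= t * 2 ^+ n.
    exists (Num.truncn (sup_norm z / t)).+1.
    rewrite mulrC -ler_pdivrMr// ltW// (lt_trans (truncnS_gt _))//.
    by rewrite -natrX ltr_nat ltn_expl.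
  (* The least such exponent is positive because [t < sup_norm z], and its predecessor indexes the
     shell containing [z]. *)
  have ex : exists n, (fun n => sup_norm z <= t * 2 ^+ n) n by exists n.
  case: (ex_minnP ex) => -[|m]; first by rewrite expr0 mulr1 leNgt tz.
  move=> zm mmin; exists m => //; apply/andP; split; last first.
    by rewrite exprS in zm; lra.
  by rewrite ltNge; apply/negP => /mmin; rewrite ltnn.
rewrite mulrAC; apply.
apply: trivIset_annulus => i j ij; left.
rewrite -[in t * _ ^+ j](subnKC ij) exprD exprS.
have h1 : 1 <= (2 : R) ^+ (j - i.+1) by rewrite exprn_ege1// ler1n.
have h2 : 0 < t * (2 : R) ^+ i by rewrite mulr_gt0// exprn_gt0.
nra.
Qed.

Lemma integral_euclid_inner {R : realType} (p t : R) : 0 < p + 2 -> 0 < t ->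
  (\int[lebesgue2 R]_(z in [set z | (sup_norm z <= t)%R]) (euclid z `^ p)%:E <=
   (16 * 4 `^ `|p| / (1 - 2^-1 `^ (p + 2)) * t `^ (p + 2))%:E)%E.
Proof.
move=> p2 t0.
have q1 : (2^-1 : R) `^ (p + 2) < 1.
  by rewrite -powR_inv1// -powRrM mulN1r powR_lt1 ?ltr1n// oppr_lt0.
have th : 0 < t / 2 by rewrite divr_gt0.
have := @integral_annuli R p (t / 2) 2^-1 th _ q1.
rewrite invr_gt0 => /(_ (ltr0Sn _ _)) H.
have mf A : measurable_fun (A : set (plane R)) (fun z : plane R =>
  (euclid z `^ p)%:E).
  apply/measurable_EFinP; apply: measurable_funTS;
    exact: measurable_euclid_powR.
have m0 : lebesgue2 R [set (0, 0)] = 0%E.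
  rewrite (_ : [set (0,0)] = [set 0] `*` [set 0]); last first.
    by apply/seteqP; split => [z ->|[x y] [/= -> ->]].
  rewrite product_measure1E; [|exact: measurable_set1..].
  rewrite [X in (X * _)%E](_ : _ = 0%E) ?mul0e//.
  exact: lebesgue_measure_set1.
(* The shells start at [t / 2], whose annulus ends at [t]; together they miss only the origin, a
   null set. *)
have U : [set z : plane R | sup_norm z <= t] =
    [set (0, 0)] `|` \bigcup_k annulus (t / 2 * 2^-1 ^+ k).
  apply/seteqP; split => z /=; last first.
    move=> [->|[k _ /andP[_]]]; first by rewrite /sup_norm /= normr0 maxxx ltW.
    move=> /le_trans; apply; rewrite mulrA [2 * _]mulrC divfK// ger_pMr//
      exprn_ile1//.
    by rewrite invf_le1// ler1n.
  move=> zt; have := sup_norm_ge0 z; rewrite le_eqVlt => /orP[/eqP z0|z0].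
    left; case: z z0 {zt} => x y; rewrite /sup_norm /= => /esym m.
    have := lexx (Num.max `|x| `|y|).
    by rewrite {2}m ge_max !normr_le0 => /andP[/eqP -> /eqP ->].
  right.
  have [n zn] : exists n, t * 2^-1 ^+ n < sup_norm z.
    exists (Num.truncn (t / sup_norm z)).+1.
    rewrite exprVn ltr_pdivrMr ?exprn_gt0// mulrC -ltr_pdivrMr//.
    by rewrite (lt_trans (truncnS_gt _))// -natrX ltr_nat ltn_expl.
  have ex : exists n, (fun n => t * 2^-1 ^+ n < sup_norm z) n by exists n.
  case: (ex_minnP ex) => -[|m]; first by rewrite expr0 mulr1 ltNge zt.
  rewrite exprS mulrA => zm mmin; exists m => //; apply/andP; split => //.
  rewrite mulrA [2 * _]mulrC divfK// leNgt; apply/negP => /mmin.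
  by rewrite ltnn.
have mb : measurable (\bigcup_k annulus (t / 2 * 2^-1 ^+ k)).
  by apply: bigcupT_measurable => k; exact: measurable_annulus.
have m1 : measurable ([set (0, 0)] : set (plane R)).
  rewrite (_ : [set (0,0)] = [set 0] `*` [set 0]).
    by apply: measurableX; exact: measurable_set1.
  by apply/seteqP; split => [z ->|[x y] [/= -> ->]].
rewrite U ge0_integral_setU; [|exact: m1|exact: mb|exact: mf| |]; last 2 first.
- by move=> z _; rewrite lee_fin powR_ge0.
- apply/disj_setPS => z [-> [k _ /andP[+ _]]].
  have k0 : 0 <= t / 2 * 2^-1 ^+ k.
    by rewrite mulr_ge0 ?(ltW th)// exprn_ge0// invr_ge0.
  by rewrite /sup_norm /= normr0 maxxx ltNge k0.
rewrite (null_set_integral m1 (mf _) m0) add0e.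
apply: (le_trans (H _)).
  apply: trivIset_annulus => i j ij; right.
  rewrite -[in t / 2 * _ ^+ j](subnKC ij) exprD exprS.
  have h1 : (2^-1 : R) ^+ (j - i.+1) <= 1.
    by rewrite exprn_ile1// ?invr_ge0// invf_le1// ler1n.
  have h2 : 0 < t / 2 * (2^-1 : R) ^+ i by rewrite mulr_gt0// exprn_gt0//
    invr_gt0.
  by move: h1 h2; set u := _ ^+ (j - i.+1); set v := _ ^+ i => h1 h2; nra.
rewrite lee_fin mulrAC ler_wpM2l//.
  by rewrite divr_ge0 ?mulr_ge0 ?powR_ge0// subr_ge0 ltW.
by apply: ge0_ler_powR; rewrite ?nnegrE ?(ltW p2) ?(ltW th) ?(ltW t0)//; lra.
Qed.

Lemma Rintegral_dominated {d} {T : measurableType d} {R : realType}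
    (mu : {measure set T -> \bar R}) (D : set T) (F g : T -> R) :
  measurable D -> measurable_fun D F -> mu.-integrable D (EFin \o g) ->
  (forall z, D z -> `|F z| <= g z) ->
  mu.-integrable D (EFin \o F) /\
  `|\int[mu]_(z in D) F z| <= \int[mu]_(z in D) g z.
Proof.
move=> mD mF intg Fg.
have mFD : measurable_fun D (EFin \o F).
  exact/measurable_EFinP.
have iF : mu.-integrable D (EFin \o F).
  apply: (le_integrable mD mFD _ intg) => z Dz /=.
  by rewrite lee_fin (le_trans (Fg _ Dz))// ler_norm.
split=> //; apply: (le_trans (le_normr_Rintegral mD iF)).
apply: le_Rintegral => //.
exact: (integrable_norm iF).
Qed.

Lemma integrable_euclid_le {R : realType} (p M : R) (D E : set (plane R)) :
  measurable D -> measurable E -> D `<=` E ->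
  (\int[lebesgue2 R]_(z in E) (euclid z `^ p)%:E <= M%:E)%E ->
  (lebesgue2 R).-integrable D (EFin \o (fun z => euclid z `^ p)) /\
  \int[lebesgue2 R]_(z in D) (euclid z `^ p) <= M.
Proof.
move=> mD mE DE EM.
have mf A : measurable_fun (A : set (plane R)) (fun z : plane R =>
  (euclid z `^ p)%:E).
  apply/measurable_EFinP; apply: measurable_funTS;
    exact: measurable_euclid_powR.
have DM : (\int[lebesgue2 R]_(z in D) (euclid z `^ p)%:E <= M%:E)%E.
  apply: le_trans EM; apply: ge0_subset_integral;
    [exact: mD|exact: mE|exact: mf| |exact: DE].
  by move=> z _; rewrite lee_fin powR_ge0.
have D0 : (0 <= \int[lebesgue2 R]_(z in D) (euclid z `^ p)%:E)%E.
  by apply: integral_ge0 => z _; rewrite lee_fin powR_ge0.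
split.
  apply/integrableP; split; first exact: mf.
  apply: le_lt_trans (ltry M); apply: le_trans DM.
  rewrite le_eqVlt; apply/orP; left; apply/eqP; apply: eq_integral => z _ /=.
  by rewrite ger0_norm ?powR_ge0.
rewrite -lee_fin fineK// ge0_fin_numE//.
by rewrite (le_lt_trans DM)// ltry.
Qed.

(** The constant depends on [p] alone, so that taking [t] to be the mesh size yields a pure power of
    h. The region [D] is left free in order to cover pieces of the quadrant. *)
Lemma outer_bound {R : realType} (p : R) : p + 2 < 0 -> exists2 C : R, 0 <= C &
  forall (t : R) (D : set (plane R)), 0 < t -> measurable D ->
    D `<=` [set z | t < sup_norm z] ->
    (lebesgue2 R).-integrable D (EFin \o (fun z => euclid z `^ p)) /\
    \int[lebesgue2 R]_(z in D) (euclid z `^ p) <= C * t `^ (p + 2).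
Proof.
move=> p2; exists (16 * 4 `^ `|p| / (1 - 2 `^ (p + 2))).
  by rewrite divr_ge0 ?mulr_ge0 ?powR_ge0// subr_ge0 ltW// powR_lt1// ltr1n.
move=> t D t0 mD Dt.
apply: (integrable_euclid_le p _ D _ mD (measurable_sup_gt t) Dt).
exact: integral_euclid_outer.
Qed.

Lemma inner_bound {R : realType} (p : R) : 0 < p + 2 -> exists2 C : R, 0 <= C &
  forall (t : R) (D : set (plane R)), 0 < t -> measurable D ->
    D `<=` [set z | sup_norm z <= t] ->
    (lebesgue2 R).-integrable D (EFin \o (fun z => euclid z `^ p)) /\
    \int[lebesgue2 R]_(z in D) (euclid z `^ p) <= C * t `^ (p + 2).
Proof.
move=> p2; exists (16 * 4 `^ `|p| / (1 - 2^-1 `^ (p + 2))).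
  rewrite divr_ge0 ?mulr_ge0 ?powR_ge0// subr_ge0 ltW//.
  by rewrite -powR_inv1// -powRrM mulN1r powR_lt1 ?ltr1n// oppr_lt0.
move=> t D t0 mD Dt.
apply: (integrable_euclid_le p _ D _ mD (measurable_sup_le t) Dt).
exact: integral_euclid_inner.
Qed.

(** * The tempered kernel and the reduction to a quadrant *)

(** With [p = 2 + beta] this is the kernel of the operator, with [p = gamma] the factor by which the
    scheme multiplies nodal values. *)
Definition tempered {R : realType} (lambda p : R) (z : R * R) : R :=
  (expR (lambda * euclid z) * euclid z `^ p)^-1.

Lemma temperedE {R : realType} (lambda p : R) (z : R * R) :
  tempered lambda p z = expR (- (lambda * euclid z)) * euclid z `^ (- p).
Proof. by rewrite /tempered invfM expRN powRN. Qed.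

Lemma measurable_tempered {R : realType} (lambda p : R) :
  measurable_fun setT (tempered lambda p : plane R -> R).
Proof.
rewrite (_ : tempered _ _ = fun z => expR (- (lambda * euclid z)) * euclid z `^
  (- p)).
  apply: measurable_funM; last exact: measurable_euclid_powR.
  apply: (measurableT_comp (@measurable_expR R)).
  apply: measurable_funN; apply: measurable_funM; first exact: measurable_cst.
  exact: measurable_euclid.
by apply/funext => z; rewrite temperedE.
Qed.

Lemma tempered_bound {R : realType} (lambda p : R) (z : R * R) : 0 <= lambda ->
  0 <= tempered lambda p z <= euclid z `^ (- p).
Proof.
move=> l0; rewrite temperedE mulr_ge0 ?expR_ge0 ?powR_ge0//=.
apply: ler_piMl; first exact: powR_ge0.
by rewrite -expR0 ler_expR oppr_le0 mulr_ge0// sqrtr_ge0.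
Qed.

Definition sym_diff {R : realType} (u : R * R -> R) (x z : R * R) : R :=
  4 * u x - (u (x.1 + z.1, x.2 + z.2) + u (x.1 - z.1, x.2 + z.2)
             + u (x.1 + z.1, x.2 - z.2) + u (x.1 - z.1, x.2 - z.2)).

Definition quadrant {R : realType} : set (plane R) := `[0, +oo[ `*` `[0, +oo[.

Lemma measurable_quadrant {R : realType} : measurable (@quadrant R).
Proof. by apply: measurableX; exact: measurable_itv. Qed.

Lemma measurable_sym_diff {R : realType} (u : R * R -> R) (x : R * R) :
  continuous u -> measurable_fun setT (sym_diff u x : plane R -> R).
Proof.
move=> /continuous_measurable_prod mu.
have mr s t : measurable_fun setT (u \o reflect2 s t x).
  exact: (measurableT_comp mu (measurable_reflect2 s t x)).
rewrite (_ : sym_diff u x = fun z => 4 * u x - ((u \o reflect2 false false x) z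
    + (u \o reflect2 true false x) z + (u \o reflect2 false true x) z
    + (u \o reflect2 true true x) z)).
  apply: measurable_funB; first exact: measurable_cst.
  by do 3 (apply: measurable_funD; last exact: mr); exact: mr.
apply/funext => z; rewrite /sym_diff /reflect2 /reflect1 /= expr0 expr1.
by rewrite !mul1r !mulN1r.
Qed.

Lemma measurable_euclid_gt {R : realType} (e : R) :
  measurable [set z : plane R | e < euclid z].
Proof.
rewrite (_ : mkset _ = @euclid R @^-1` `]e, +oo[).
  by rewrite -[X in measurable X]setTI; exact: measurable_euclid.
by apply/seteqP; split => z /=; rewrite in_itv /= andbT.
Qed.

Lemma euclid_reflect2 {R : realType} (s t : bool) (z : plane R) :
  euclid (reflect2 s t (0, 0) z) = euclid z.
Proof. by rewrite /euclid /reflect2 /reflect1 /= !add0r !exprMn !sqrr_sign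
  !mul1r. Qed.

Lemma lebesgue_axis1 {R : realType} : lebesgue2 R [set z :
  plane R | z.1 = 0] = 0%E.
Proof.
rewrite (_ : mkset _ = [set 0] `*` setT); last by apply/seteqP;
  split => z // [].
rewrite product_measure1E; [|exact: measurable_set1|exact: measurableT].
by rewrite [X in (X * _)%E](_ : _ = 0%E) ?mul0e//; exact: lebesgue_measure_set1.
Qed.

Lemma lebesgue_axis2 {R : realType} : lebesgue2 R [set z :
  plane R | z.2 = 0] = 0%E.
Proof.
rewrite (_ : mkset _ = setT `*` [set 0]); last by apply/seteqP;
  split => z // [].
rewrite product_measure1E; [|exact: measurableT|exact: measurable_set1].
by rewrite [X in (_ * X)%E](_ : _ = 0%E) ?mule0//; exact: lebesgue_measure_set1.
Qed.

(** Away from the singularity boundedness of [u] and the decay [|z| ^ -(2 + beta)] give absolute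
    integrability, so the four reflected pieces may be separated and recombined before any
    cancellation is used. *)
Lemma truncated_integral_quadrant {R : realType} (beta lambda M eps : R)
    (u : R * R -> R) (x : R * R) :
  0 < beta -> 0 <= lambda -> continuous u -> (forall y,
    `|u y| <= M) -> 0 < eps ->
  (lebesgue2 R).-integrable ([set z | eps < euclid z] `&` quadrant)
     (EFin \o (fun z => sym_diff u x z * tempered lambda (2 + beta) z)) /\
  truncated_integral beta lambda u x eps =
  \int[lebesgue2 R]_(z in [set z | eps < euclid z] `&` quadrant)
     (sym_diff u x z * tempered lambda (2 + beta) z).
Proof.
move=> b0 l0 cu uM e0.
pose F z : R := (u x - u (reflect2 false false x z)) * tempered lambda (2 +
  beta) z.
have mu := continuous_measurable_prod _ cu.
have mF : measurable_fun setT (F : plane R -> R).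
  apply: measurable_funM; last exact: measurable_tempered.
  apply: measurable_funB; first exact: measurable_cst.
  exact: (measurableT_comp mu (measurable_reflect2 false false x)).
pose D : set (plane R) := [set z | eps < euclid z].
have mD : measurable D by exact: measurable_euclid_gt.
have [C C0 hC] := @outer_bound R (- (2 + beta)) ltac:(lra).
(* The radius is [eps / 2] because [euclid z <= 2 * sup_norm z]. *)
have [iK _] : (lebesgue2 R).-integrable D (EFin \o (fun z =>
  euclid z `^ (- (2 + beta)))) /\
   \int[lebesgue2 R]_(z in D) (euclid z `^ (- (2 + beta))) <=
     C * (eps / 2) `^ (- (2 + beta) + 2).
  apply: hC; [by rewrite divr_gt0|exact: mD|].
  by move=> z; rewrite /D /= => ez; have /andP[_] := sup_norm_euclid z; lra.
have [iF _] : (lebesgue2 R).-integrable D (EFin \o F) /\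
    `|\int[lebesgue2 R]_(z in D) F z| <= \int[lebesgue2 R]_(z in D) (2 * M *
      euclid z `^ (- (2 + beta))).
  apply: Rintegral_dominated; [exact: mD|exact: measurable_funTS mF| |].
    exact: (integrableZl mD (2 * M) iK).
  move=> z _; rewrite /F normrM; have /andP[k0 k1] :=
    tempered_bound lambda (2 + beta) z l0.
  rewrite (ger0_norm k0); apply: ler_pM => //.
  rewrite (le_trans (ler_normB _ _))//.
  by have := uM x; have := uM (reflect2 false false x z); lra.
have rff z : reflect2 false false x z = (x.1 + z.1, x.2 + z.2) :> R * R.
  by rewrite /reflect2 /reflect1 /= expr0 !mul1r.
have rtf (z : plane R) : reflect2 true false (0, 0) z = (- z.1, z.2) :> R * R.
  by rewrite /reflect2 /reflect1 /= expr0 expr1 mul1r mulN1r !add0r.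
have rft (z : plane R) : reflect2 false true (0, 0) z = (z.1, - z.2) :> R * R.
  by rewrite /reflect2 /reflect1 /= expr0 expr1 mul1r mulN1r !add0r.
have T1 : truncated_integral beta lambda u x eps = \int[lebesgue2 R]_(z in D) F
  z.
  pose D0 : set (plane R) := [set y : R * R | eps < euclid (x - y)].
  pose f (y : plane R) : R := (u x - u y) * tempered lambda (2 + beta) (x - y).
  have xe (z : plane R) : euclid (x - reflect2 false false x z) = euclid z.
    rewrite rff /euclid /=; congr (Num.sqrt (_ + _)).
      by rewrite opprD addNKr sqrrN.
    by rewrite opprD addNKr sqrrN.
  have xt (z : plane R) : tempered lambda (2 + beta) (x - reflect2 false false x
    z) =
    tempered lambda (2 + beta) z by rewrite /tempered xe.
  have mxy : measurable_fun setT ((fun y => x - y) : plane R -> plane R).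
    rewrite (_ : (fun y => x - y) = reflect2 true true x).
      exact: measurable_reflect2.
    by apply/funext => z; rewrite /reflect2 /reflect1 /= expr1 !mulN1r.
  have mD0 : measurable D0.
    rewrite (_ : D0 = (fun y => x - y) @^-1` D) //.
    by rewrite -[X in measurable X]setTI; exact: mxy.
  have mf : measurable_fun setT f.
    apply: measurable_funM; first by apply: measurable_funB;
      [exact: measurable_cst|exact: mu].
    exact: (measurableT_comp (measurable_tempered lambda (2 + beta)) mxy).
  have pD : reflect2 false false x @^-1` D0 = D.
    by apply/seteqP; split => z; rewrite /D0 /D /= xe.
  have fF : f \o reflect2 false false x = F.
    by apply/funext => z; rewrite /f /F /= xt.
  have [|_] := integral_reflect2 false false x D0 f mD0 mf.
    by rewrite pD fF; exact: iF.
  rewrite pD => E.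
  have -> : truncated_integral beta lambda u x eps = \int[lebesgue2 R]_(y in D0)
    f y.
    reflexivity.
  rewrite E.
  apply: eq_Rintegral => z _.
  exact: (congr1 (@^~ z) fF).
pose H1 : set (plane R) := [set z | 0 <= z.1].
pose H2 : set (plane R) := [set z | 0 <= z.2].
have mH1 : measurable H1.
  rewrite (_ : H1 = `[0, +oo[ `*` setT).
    by apply: measurableX; [exact: measurable_itv|exact: measurableT].
  apply/seteqP; split => z; rewrite /H1 /= in_itv /= andbT; last by case.
  by move=> h; split.
have mH2 : measurable H2.
  rewrite (_ : H2 = setT `*` `[0, +oo[).
    by apply: measurableX; [exact: measurableT|exact: measurable_itv].
  apply/seteqP; split => z; rewrite /H2 /= in_itv /= andbT; last by case.
  by move=> h; split.
have s1D : reflect2 true false (0, 0) @^-1` D = D.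
  by apply/seteqP; split => z; rewrite /D /= euclid_reflect2.
have s2D : reflect2 false true (0, 0) @^-1` (D `&` H1) = D `&` H1.
  by apply/seteqP; split => z; rewrite /D /H1 /= euclid_reflect2 /reflect1 expr0
    mul1r add0r.
have [||] := integral_fold true false D H1 F mD mH1 mF s1D _ _ iF.
- by move=> z; rewrite /H1 /= /reflect1 expr1 mulN1r add0r => /negP;
  rewrite -ltNge; lra.
- rewrite -[RHS](@lebesgue_axis1 R); congr (lebesgue2 R _).
  apply/seteqP; split => z; rewrite /H1 /= /reflect1 expr1 mulN1r add0r.
    by move=> [z0 /contrapT]; lra.
  by move=> ->; rewrite oppr0 lexx; split; [exact: isT|move=> h;
    exact: (h isT)].
set F1 := fun z => F z + _; move=> i1 E1.
have mF1 : measurable_fun setT F1.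
  apply: measurable_funD; first exact: mF.
  exact: (measurableT_comp mF (measurable_reflect2 true false (0, 0))).
have [||] := integral_fold false true (D `&` H1) H2 F1 (measurableI _ _ mD mH1)
  mH2 mF1 s2D _ _ i1.
- by move=> z; rewrite /H2 /= /reflect1 expr1 mulN1r add0r => /negP;
  rewrite -ltNge; lra.
- rewrite -[RHS](@lebesgue_axis2 R); congr (lebesgue2 R _).
  apply/seteqP; split => z; rewrite /H2 /= /reflect1 expr1 mulN1r add0r.
    by move=> [z0 /contrapT]; lra.
  by move=> ->; rewrite oppr0 lexx; split; [exact: isT|move=> h;
    exact: (h isT)].
rewrite T1 E1 => i2 ->.
have DQ : D `&` H1 `&` H2 = [set z | eps < euclid z] `&` quadrant.
  apply/seteqP; split => z; rewrite /H1 /H2 /quadrant /= !in_itv /= !andbT.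
    by case=> [[a b] c]; exact: (conj a (conj b c)).
  by case=> [a [b c]]; exact: (conj (conj a b) c).
(* The kernel is invariant under sign changes, so it factors out of the four copies of [F]. *)
have FE : (fun z => F1 z + F1 (reflect2 false true (0, 0) z)) =
    fun z => sym_diff u x z * tempered lambda (2 + beta) z.
  apply/funext => z; rewrite /F1 /F /tempered !euclid_reflect2 !rff rtf rft rtf
    /=.
  by rewrite /sym_diff; set k := _^-1; ring.
rewrite DQ FE in i2; rewrite DQ; split; first exact: i2.
apply: eq_Rintegral => z _; exact: (congr1 (@^~ z) FE).
Qed.

(** * Linear interpolation of C^{1,1} functions *)

Lemma mean_value {R : realType} (f df : R -> R) (a b x y : R) :
  (forall s, a <= s <= b -> is_derive s 1 f (df s)) ->
  a <= x <= b -> a <= y <= b ->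
  exists c, [/\ f y - f x = df c * (y - x), a <= c <= b,
                `|c - x| <= `|y - x| & `|c - y| <= `|y - x|].
Proof.
move=> fdf; wlog xy : x y / x <= y => [H|].
  case: (leP x y) => [|/ltW] yx hx hy; first exact: H.
  have [c [e h1 h2 h3]] := H _ _ yx hy hx.
  by exists c; split=> //; [lra|rewrite (distrC y)|rewrite (distrC y)].
move=> /andP[ax xb] /andP[ay yb].
have fdf' s : s \in `[x, y] -> is_derive s 1 f (df s).
  by rewrite in_itv /= => /andP[h1 h2]; apply: fdf; lra.
have cf : {within `[x, y], continuous f}.
  apply: continuous_in_subspaceT => s; rewrite inE => /fdf' fs.
  exact/differentiable_continuous/derivable1_diffP/ex_derive.
have fdfo s (h : s \in `]x, y[) := fdf' s (subset_itv_oo_cc h).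
have [c] := @MVT_segment R f df x y xy fdfo cf.
rewrite in_itv /= => /andP[h1 h2] e; exists c; split => //; first by lra.
- by rewrite !ger0_norm; lra.
- by rewrite distrC !ger0_norm; lra.
Qed.

(** A Lipschitz derivative, kept as explicit data, is the only regularity that the Taylor and
    interpolation estimates consume. *)
Definition C11_on {R : realType} (a b M : R) (f df : R -> R) : Prop :=
  (forall s, a <= s <= b -> is_derive s 1 f (df s)) /\
  (forall s t, a <= s <= b -> a <= t <= b -> `|df s - df t| <= M * `|s - t|).

(** The mean value theorem gives the remainder [(df c - df x) * (y - x)] with [c] between [x] and
    [y]; this yields the constant [M] rather than the sharp [M / 2]. *)
Lemma C11_taylor {R : realType} (a b M : R) (f df : R -> R) (x y : R) :
  C11_on a b M f df -> 0 <= M -> a <= x <= b -> a <= y <= b ->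
  `|f y - f x - df x * (y - x)| <= M * (y - x) ^+ 2.
Proof.
move=> [fdf L] M0 hx hy; have [c [e hc cx _]] :=
  mean_value f df a b x y fdf hx hy.
rewrite e -mulrBl normrM -(real_normK (num_real (y - x))) expr2 mulrA.
rewrite ler_wpM2r//; apply: le_trans (L _ _ hc hx) _.
by rewrite ler_wpM2l.
Qed.

Lemma linear_interpolation {R : realType} (a b M : R) (f df : R -> R) (t : R) :
  C11_on a b M f df -> 0 <= M -> a <= b -> 0 <= t <= 1 ->
  `|(1 - t) * f a + t * f b - f ((1 - t) * a + t * b)| <= M * (b - a) ^+ 2.
Proof.
move=> C M0 ab /andP[t0 t1]; set m := (1 - t) * a + t * b.
have hm : a <= m <= b by rewrite /m; apply/andP; split; nra.
have h1 := C11_taylor a b M f df m a C M0 hm ltac:(lra).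
have h2 := C11_taylor a b M f df m b C M0 hm ltac:(lra).
(* Both endpoint values are expanded at [m]; the first-order terms cancel since
   [(1 - t) * (a - m) + t * (b - m) = 0]. *)
have -> : (1 - t) * f a + t * f b - f m =
  (1 - t) * (f a - f m - df m * (a - m)) + t * (f b - f m - df m * (b - m)).
  rewrite /m; ring.
have {}h1 : `|f a - f m - df m * (a - m)| <= M * (b - a) ^+ 2.
  apply: (le_trans h1); rewrite ler_wpM2l//.
  rewrite (_ : a - m = - (t * (b - a))); last by rewrite /m; ring.
  by rewrite sqrrN exprMn ler_piMl ?sqr_ge0// exprn_ile1.
have {}h2 : `|f b - f m - df m * (b - m)| <= M * (b - a) ^+ 2.
  apply: (le_trans h2); rewrite ler_wpM2l//.
  rewrite (_ : b - m = (1 - t) * (b - a)); last by rewrite /m; ring.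
  by rewrite exprMn ler_piMl ?sqr_ge0// exprn_ile1//; lra.
apply: (le_trans (ler_normD _ _)); rewrite !normrM.
rewrite (@ger0_norm _ (1 - t)); last by lra.
rewrite (ger0_norm t0).
have := ler_wpM2l t0 h2; have := ler_wpM2l (_ : 0 <= 1 - t) h1.
by move=> /(_ ltac:(lra)); lra.
Qed.

Lemma symmetric_difference2 {R : realType} (M : R) (f df : R -> R) (x s : R) :
  (forall a b, C11_on a b M f df) -> 0 <= M ->
  `|f (x + s) + f (x - s) - 2 * f x| <= 2 * M * s ^+ 2.
Proof.
move=> C M0.
have T y : `|f y - f x - df x * (y - x)| <= M * (y - x) ^+ 2.
  by apply: (C11_taylor (Num.min x y) (Num.max x y) _ _ _ _ _ (C _ _) M0);
     rewrite ge_min le_max lexx ?orbT.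
have h1 := T (x + s); have h2 := T (x - s).
rewrite (_ : f (x + s) + f (x - s) - 2 * f x =
  (f (x + s) - f x - df x * (x + s - x)) + (f (x - s) - f x - df x * (x - s -
    x))); last by ring.
apply: (le_trans (ler_normD _ _)).
rewrite (_ : x + s - x = s) in h1 *; last by ring.
rewrite (_ : x - s - x = - s) in h2 *; last by ring.
by rewrite sqrrN in h2; lra.
Qed.

(** The increment is controlled by a difference of two values of [df] at points at most [2 * S]
    apart. The resulting factor [S] later absorbs the factor [1 / r] of the derivative of the
    kernel. *)
Lemma symmetric_sum_lipschitz {R : realType} (M S : R) (f df : R -> R) (x s t :
  R) :
  (forall a b, C11_on a b M f df) -> 0 <= M -> 0 <= s <= S -> 0 <= t <= S ->
  `|f (x + s) + f (x - s) - (f (x + t) + f (x - t))| <= 2 * M * S * `|s - t|.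
Proof.
move=> C M0 hs ht.
have D (a b : R) : forall c : R, a <= c <= b ->
  is_derive c 1 f (df c) by have [] := C a b.
have [c [ec hc _ _]] := mean_value f df x (x + S) (x + t) (x + s) (D _ _)
  ltac:(lra) ltac:(lra).
have [d [ed hd _ _]] := mean_value f df (x - S) x (x - t) (x - s) (D _ _)
  ltac:(lra) ltac:(lra).
have -> : f (x + s) + f (x - s) - (f (x + t) + f (x - t)) = (df c - df d) * (s -
  t).
  rewrite opprD addrACA ec ed; ring.
rewrite normrM ler_wpM2r//.
have [_ /(_ c d)] := C (x - S) (x + S).
move=> /(_ ltac:(lra) ltac:(lra)) /le_trans; apply.
rewrite -mulrA mulrCA ler_wpM2l// ler_norml; lra.
Qed.

Lemma is_derive_mul {R : realType} (f g : R -> R) (s df dg : R) :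
  is_derive s 1 f df -> is_derive s 1 g dg ->
  is_derive s 1 (fun x => f x * g x) (df * g s + f s * dg).
Proof.
move=> hf hg; apply: (is_derive_eq (is_deriveM hf hg)).
by rewrite addrC [g s *: df]mulrC.
Qed.

(** * Derivatives of the kernel along a line *)

Lemma is_derive_euclid {R : realType} (q s : R) : 0 < euclid (s, q) ->
  is_derive s 1 (fun x => euclid (x, q)) (s / euclid (s, q)).
Proof.
move=> h; have h2 : 0 < s ^+ 2 + q ^+ 2 by move: h; rewrite sqrtr_gt0.
have d1 : is_derive s 1 (fun x : R => x ^+ 2 + q ^+ 2) (2 * s).
  apply: (is_derive_eq (is_deriveD (is_deriveX 2 (is_derive_id s (1 :
    R))) (is_derive_cst (q ^+ 2) s 1))).
  by rewrite addr0 expr1 /GRing.scale /= mulr1.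
apply: (is_derive_eq (@is_derive1_comp _ Num.sqrt (fun x =>
  x ^+ 2 + q ^+ 2) s _ _ (is_derive1_sqrt h2) d1)).
rewrite invfM /euclid /=; field.
by rewrite sqrtr_eq0 -ltNge.
Qed.

Lemma is_derive_euclidV {R : realType} (q s : R) : 0 < euclid (s, q) ->
  is_derive s 1 (fun x => (euclid (x, q))^-1) (- s * (euclid (s, q))^-1 ^+ 3).
Proof.
move=> h; have h0 : euclid (s, q) != 0 by rewrite gt_eqF.
apply: (is_derive_eq (@is_deriveV _ (fun x => euclid (x,
  q)) s _ 1 h0 (is_derive_euclid q s h))).
by rewrite /GRing.scale /=; field.
Qed.

Lemma is_derive_tempered {R : realType} (lambda p q s : R) : 0 < euclid (s,
  q) ->
  is_derive s 1 (fun x => tempered lambda p (x, q))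
    (- ((lambda + p * (euclid (s, q))^-1) * (s * (euclid (s, q))^-1)
        * tempered lambda p (s, q))).
Proof.
move=> h; have hr := is_derive_euclid q s h.
have d1 : is_derive s 1 (fun x => expR (- lambda * euclid (x, q)))
    (expR (- lambda * euclid (s, q)) * (- lambda * (s / euclid (s, q)))).
  exact: (@is_derive1_comp _ expR (fun x => - lambda * euclid (x,
    q)) s _ _ (is_derive_expR _) (is_deriveZ (- lambda) hr)).
have d2 := @is_derive1_comp _ (fun y => y `^ (- p)) (fun x => euclid (x,
  q)) s _ _ (is_derive1_powR (- p) h) hr.
rewrite (_ : (fun x => tempered lambda p (x, q)) =
  (fun x => expR (- lambda * euclid (x, q)) * euclid (x, q) `^ (- p)));
    last first.
  by apply/funext => x; rewrite temperedE mulNr.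
apply: (is_derive_eq (is_derive_mul _ _ _ _ _ d1 d2)).
rewrite temperedE -(mulNr lambda (euclid _)) /= powRB;
  last by apply/implyP => _; rewrite gt_eqF.
rewrite powRr1; last exact: ltW.
by field; rewrite gt_eqF.
Qed.

(** Each derivative costs [1 / r]. Exponential and power are treated alike by writing
    [lambda + p / euclid <= A / euclid], which holds because [euclid <= S]; this is the origin of
    [A]. *)
Lemma tempered_C11_on {R : realType} (lambda p q a b r S : R) :
  0 <= lambda -> 0 <= p -> 0 < r ->
  (forall s, a <= s <= b -> r <= euclid (s, q) <= S) ->
  let A := lambda * S + p in
  C11_on a b ((p + A + A ^+ 2) * (r `^ (- p) * r^-1 ^+ 2))
    (fun s => tempered lambda p (s, q))
    (fun s => - ((lambda + p * (euclid (s, q))^-1) * (s * (euclid (s, q))^-1)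
        * tempered lambda p (s, q))) /\
  (forall s t, a <= s <= b -> a <= t <= b ->
    `|tempered lambda p (s, q) - tempered lambda p (t, q)| <=
      A * (r `^ (- p) * r^-1) * `|s - t|).
Proof.
move=> l0 p0 r0 hr A.
pose i s := (euclid (s, q))^-1.
pose g s := tempered lambda p (s, q).
have er0 s : a <= s <= b -> 0 < euclid (s, q).
  by move=> /hr /andP[rs _]; exact: lt_le_trans rs.
have hi s : a <= s <= b -> [/\ 0 < i s <= r^-1, `|s * i s| <= 1,
    0 <= lambda + p * i s, lambda + p * i s <= A * i s & 0 <= g s <=
      r `^ (- p)].
  move=> hs; have e0 := er0 s hs; have /andP[rs sS] := hr s hs.
  have i0 : 0 < i s by rewrite invr_gt0.
  split.
  - by rewrite i0 lef_pV2 ?posrE.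
  - rewrite normrM (gtr0_norm i0) ler_pdivrMr// mul1r.
    rewrite -(@ler_pXn2r _ 2) ?nnegrE ?(ltW e0)// real_normK ?num_real//.
    by rewrite sqr_sqrtr ?addr_ge0 ?sqr_ge0//= lerDl sqr_ge0.
  - by rewrite addr_ge0// mulr_ge0// ltW.
  - rewrite /A mulrDl lerD2r -mulrA ler_peMr// /i ler_pdivlMr// mul1r//.
  - have /andP[g0 g1] := tempered_bound lambda p (s, q) l0.
    rewrite /g g0 (le_trans g1)// !powRN lef_pV2 ?posrE ?powR_gt0//.
    by apply: ge0_ler_powR; rewrite ?nnegrE ?(ltW e0) ?(ltW r0).
pose dg s := - ((lambda + p * i s) * (s * i s) * g s).
have gd (s : R) : a <= s <= b -> is_derive s 1 g (dg s).
  by move=> /er0; exact: is_derive_tempered.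
have gpos : 0 < r `^ (- p) by exact: powR_gt0.
have ri : 0 < r^-1 by rewrite invr_gt0.
have A0 s : a <= s <= b -> 0 <= A.
  by move=> /hi [/andP[i0 _] _ h /(le_trans h) + _]; rewrite pmulr_lge0.
have dgb' s : a <= s <= b -> `|dg s| <= A * i s * g s.
  move=> hs; have [/andP[h1 h2] h3 h4 h5 /andP[h6 h7]] := hi s hs.
  rewrite /dg normrN normrM (ger0_norm h6) ler_wpM2r//.
  rewrite [X in X <= _]normrM (ger0_norm h4).
  by apply: le_trans h5; rewrite ler_piMr.
have dgb s : a <= s <= b -> `|dg s| <= A * (r `^ (- p) * r^-1).
  move=> hs; have [/andP[h1 h2] h3 h4 h5 /andP[h6 h7]] := hi s hs.
  apply: (le_trans (dgb' s hs)); rewrite -mulrA ler_wpM2l ?(A0 s)//.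
  by rewrite mulrC ler_pM// ltW.
have iD (s : R) : a <= s <= b -> is_derive s 1 i (- s * i s ^+ 3).
  by move=> /er0; exact: is_derive_euclidV.
pose d2g s := - ((p * (- s * i s ^+ 3) * (s * i s)
    + (lambda + p * i s) * (i s + s * (- s * i s ^+ 3))) * g s
    + (lambda + p * i s) * (s * i s) * dg s).
have dgd (s : R) : a <= s <= b -> is_derive s 1 dg (d2g s).
  move=> hs; have d1 := iD s hs; have d0 := gd s hs.
  have d2 : is_derive s 1 (fun x => lambda + p * i x) (p * (- s * i s ^+ 3)).
    apply: (is_derive_eq (is_deriveD (is_derive_cst lambda s 1) (is_deriveZ p
      d1))).
    by rewrite add0r.
  have d3 := is_derive_mul _ _ _ _ _ (is_derive_id s (1 : R)) d1.
  have d4 := is_derive_mul _ _ _ _ _ (is_derive_mul _ _ _ _ _ d2 d3) d0.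
  by apply: (is_derive_eq (is_deriveN d4)); rewrite /d2g mul1r.
have d2gb s : a <= s <= b -> `|d2g s| <= (p + A + A ^+ 2) * (r `^ (- p) * r^-1
  ^+ 2).
  move=> hs; have [/andP[h1 h2] h3 h4 h5 /andP[h6 h7]] := hi s hs.
  (* Grouped so that [s * i s], of modulus at most 1, is isolated; the three terms are then at most
     [p], [A] and [A ^+ 2] times [i s ^+ 2 * g s]. *)
  have E : d2g s = p * (s * i s) ^+ 2 * (i s ^+ 2 * g s)
      - (lambda + p * i s) * (1 - (s * i s) ^+ 2) * (i s * g s)
      - (lambda + p * i s) * (s * i s) * dg s by rewrite /d2g; ring.
  have s1 : 0 <= (s * i s) ^+ 2 <= 1.
    by rewrite sqr_ge0 -(real_normK (num_real (s * i s))) exprn_ile1.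
  have b0 : i s ^+ 2 * g s <= r `^ (- p) * r^-1 ^+ 2.
    by rewrite mulrC ler_pM ?sqr_ge0// ler_pXn2r ?nnegrE// ltW.
  have c0 : 0 <= i s ^+ 2 * g s by rewrite mulr_ge0 ?sqr_ge0.
  have t1 : `|p * (s * i s) ^+ 2 * (i s ^+ 2 * g s)| <= p * (i s ^+ 2 * g s).
    have [s0 s2] := andP s1.
    rewrite ger0_norm; last by rewrite mulr_ge0// mulr_ge0.
    by rewrite ler_wpM2r// ler_piMr.
  have t2 : `|(lambda + p * i s) * (1 - (s * i s) ^+ 2) * (i s * g s)| <=
    A * (i s ^+ 2 * g s).
    have ig : 0 <= i s * g s by rewrite mulr_ge0 ?(ltW h1).
    rewrite [X in X <= _]normrM (ger0_norm ig) expr2 -!mulrA [A * _]mulrA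
      ler_wpM2r//.
    rewrite normrM (ger0_norm h4); apply: le_trans h5.
    by rewrite ler_piMr// ger0_norm; lra.
  have t3 : `|(lambda + p * i s) * (s * i s) * dg s| <=
    A ^+ 2 * (i s ^+ 2 * g s).
    rewrite [X in X <= _]normrM.
    rewrite (_ : A ^+ 2 * _ = A * i s * (A * i s * g s)); last by ring.
    rewrite ler_pM// ?dgb'//.
    rewrite [X in X <= _]normrM (ger0_norm h4).
    by apply: le_trans h5; rewrite ler_piMr.
  rewrite E; apply: (le_trans (ler_normB _ _)).
  apply: (le_trans (lerD (ler_normB _ _) t3)).
  apply: (le_trans (lerD (lerD t1 t2) (lexx _))).
  have a0 := A0 s hs.
  by rewrite -!mulrDl ler_wpM2l// addr_ge0 ?sqr_ge0// addr_ge0.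
split; last first.
  move=> s t hs ht; have [c [-> hc _ _]] := mean_value g dg a b t s gd ht hs.
  by rewrite normrM ler_wpM2r// dgb.
split=> // s t hs ht.
have [c [-> hc _ _]] := mean_value dg d2g a b t s dgd ht hs.
by rewrite normrM ler_wpM2r// d2gb.
Qed.

(** * The symmetrized difference and its product with the kernel *)

(** One constant for all axis-parallel lines makes the later estimates uniform in the base point. *)
Definition partials_C11 {R : realType} (M : R) (u : R * R -> R) : Prop :=
  (forall y, exists df, forall a b, C11_on a b M (fun s => u (s, y)) df) /\
  (forall x, exists df, forall a b, C11_on a b M (fun s => u (x, s)) df).

Lemma sym_diff_bound {R : realType} (M : R) (u : R * R -> R) (x z : R * R) :
  partials_C11 M u -> 0 <= M ->
  `|sym_diff u x z| <= 4 * M * euclid z ^+ 2.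
Proof.
move=> [C1 C2] M0.
have [d1 h1] := C1 (x.2 + z.2); have [d2 h2] := C1 (x.2 - z.2);
  have [d3 h3] := C2 x.1.
(* Up to sign, [sym_diff] is the sum of the horizontal second differences at the heights [x.2 + z.2]
   and [x.2 - z.2] and of twice the vertical one at [x.1]. *)
have e1 := symmetric_difference2 M _ d1 x.1 z.1 h1 M0.
have e2 := symmetric_difference2 M _ d2 x.1 z.1 h2 M0.
have e3 := symmetric_difference2 M _ d3 x.2 z.2 h3 M0.
rewrite /= -surjective_pairing in e3.
rewrite sqr_sqrtr ?addr_ge0 ?sqr_ge0// /sym_diff.
move: e1 e2 e3; rewrite !ler_norml; lra.
Qed.

Lemma sym_diff_lipschitz {R : realType} (M S : R) (u : R * R -> R) (x :
  R * R) (q s t : R) :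
  partials_C11 M u -> 0 <= M -> 0 <= s <= S -> 0 <= t <= S ->
  `|sym_diff u x (s, q) - sym_diff u x (t, q)| <= 4 * M * S * `|s - t|.
Proof.
move=> [C1 _] M0 hs ht.
have [d1 h1] := C1 (x.2 + q); have [d2 h2] := C1 (x.2 - q).
have := symmetric_sum_lipschitz M S _ d1 x.1 s t h1 M0 hs ht.
have := symmetric_sum_lipschitz M S _ d2 x.1 s t h2 M0 hs ht.
rewrite /sym_diff /= !ler_norml; lra.
Qed.

Lemma sym_diff_interpolation {R : realType} (M : R) (u : R * R -> R) (x : R * R)
    (q a b t : R) :
  partials_C11 M u -> 0 <= M -> a <= b -> 0 <= t <= 1 ->
  `|(1 - t) * sym_diff u x (a, q) + t * sym_diff u x (b, q)
    - sym_diff u x ((1 - t) * a + t * b, q)| <= 4 * M * (b - a) ^+ 2.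
Proof.
move=> [C1 _] M0 ab t01.
have [d1 h1] := C1 (x.2 + q); have [d2 h2] := C1 (x.2 - q).
have ab1 : x.1 + a <= x.1 + b by rewrite lerD2l.
have ab2 : x.1 - b <= x.1 - a by rewrite lerD2l lerN2.
have t01' : 0 <= 1 - t <= 1 by lra.
have e1 := linear_interpolation _ _ M _ d1 t (h1 _ _) M0 ab1 t01.
have e2 := linear_interpolation _ _ M _ d2 t (h2 _ _) M0 ab1 t01.
(* Reflection reverses the segment, which now runs from [x.1 - b] to [x.1 - a], so the weights are
   exchanged. *)
have e3 := linear_interpolation _ _ M _ d1 (1 - t) (h1 _ _) M0 ab2 t01'.
have e4 := linear_interpolation _ _ M _ d2 (1 - t) (h2 _ _) M0 ab2 t01'.
have E1 : (1 - t) * (x.1 + a) + t * (x.1 + b) = x.1 + ((1 - t) * a + t * b) by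
  ring.
have E2 : (1 - (1 - t)) * (x.1 - b) + (1 - t) * (x.1 - a) = x.1 - ((1 - t) * a +
  t * b) by ring.
have E3 : x.1 + b - (x.1 + a) = b - a by ring.
have E4 : x.1 - a - (x.1 - b) = b - a by ring.
rewrite E1 E3 in e1 e2; rewrite E2 E4 in e3 e4.
move: e1 e2 e3 e4; rewrite /sym_diff /=; set m := (1 - t) * a + t * b.
set W := M * _; rewrite -mulrA -/W !ler_norml; lra.
Qed.

(* With I the linear interpolation at a point m,
   I(fg) - fg(m) = (If - f(m)) g(m) + f(m) (Ig - g(m)) + I((f - f(m))(g -
     g(m))). *)
Lemma interpolation_mul {R : realType} (t f0 f1 f g0 g1 g e1 e2 F G d D : R) :
  0 <= t <= 1 ->
  `|(1 - t) * f0 + t * f1 - f| <= e1 -> `|(1 - t) * g0 + t * g1 - g| <= e2 ->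
  `|f| <= F -> `|g| <= G ->
  `|f0 - f| <= d -> `|f1 - f| <= d -> `|g0 - g| <= D -> `|g1 - g| <= D ->
  `|(1 - t) * (f0 * g0) + t * (f1 * g1) - f * g| <= e1 * G + F * e2 + d * D.
Proof.
move=> /andP[t0 t1] h1 h2 hF hG d0 d1 D0 D1.
have -> : (1 - t) * (f0 * g0) + t * (f1 * g1) - f * g =
  ((1 - t) * f0 + t * f1 - f) * g + f * ((1 - t) * g0 + t * g1 - g) +
  ((1 - t) * ((f0 - f) * (g0 - g)) + t * ((f1 - f) * (g1 - g))) by ring.
have P a b A B : `|a| <= A -> `|b| <= B -> `|a * b| <= A * B :> R.
  by move=> ? ?; rewrite normrM ler_pM.
have p1 := P _ _ _ _ h1 hG; have p2 := P _ _ _ _ hF h2.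
have p3 := P _ _ _ _ d0 D0; have p4 := P _ _ _ _ d1 D1.
apply: (le_trans (ler_normD _ _)); apply: lerD.
  by apply: (le_trans (ler_normD _ _)); apply: lerD.
apply: (le_trans (ler_normD _ _)); rewrite !normrM (ger0_norm t0) ger0_norm
  ?subr_ge0//.
rewrite !normrM in p3 p4.
have -> : d * D = (1 - t) * (d * D) + t * (d * D) by ring.
by apply: lerD; rewrite ler_wpM2l// subr_ge0.
Qed.

Definition psi {R : realType} (lambda gamma : R) (u : R * R -> R) (x z :
  R * R) : R :=
  sym_diff u x z * tempered lambda gamma z.

(** With r the distance of the near endpoint, [b - a <= r] keeps the segment within [2 * r]. The
    product rule for interpolation then pairs r^2 with r^(-gamma - 2) and r with r^(-gamma - 1),
    leaving r^-gamma each time. *)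
Lemma psi_interpolation {R : realType} (M S lambda gamma : R) : 0 <= M ->
  0 <= lambda -> 0 <= gamma -> 0 <= S ->
  exists2 C : R, 0 <= C & forall (u : R * R -> R) (x : R * R) (q a b t : R),
    partials_C11 M u -> 0 <= a -> a <= b -> 0 <= q -> 0 <= t <= 1 ->
    0 < euclid (a, q) -> b - a <= euclid (a, q) -> euclid (b, q) <= S ->
    `|(1 - t) * psi lambda gamma u x (a, q) + t * psi lambda gamma u x (b, q)
      - psi lambda gamma u x ((1 - t) * a + t * b, q)|
    <= C * ((b - a) ^+ 2 * euclid (a, q) `^ (- gamma)).
Proof.
move=> M0 l0 g0 S0; pose A := lambda * S + gamma; pose B := gamma + A + A ^+ 2.
have A0 : 0 <= A by rewrite addr_ge0// mulr_ge0.
have B0 : 0 <= B by rewrite addr_ge0 ?sqr_ge0// addr_ge0.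
(* The error of [sym_diff] gives 4; its size, at most 4 M (2 r)^2, against the error of the kernel
   gives [16 * B]; its increments, at most 4 M (2 r) h, against those of the kernel give [8 * A]. *)
exists (M * (4 + 16 * B + 8 * A)).
  by rewrite mulr_ge0// !addr_ge0// mulr_ge0.
move=> u x q a b t hu a0 ab q0 t01 r0 hr bS.
set r := euclid (a, q) in r0 hr *; set h := b - a in hr *;
  set m := (1 - t) * a + t * b.
have [t0 t1] := andP t01.
have am : a <= m <= b by rewrite /m; apply/andP; split; nra.
have h0 : 0 <= h by rewrite subr_ge0.
have ar : a <= r.
  by rewrite -(@ler_pXn2r _ 2) ?nnegrE ?(ltW r0)//
    /r euclid_sqr /= lerDl sqr_ge0.
have mono s s' : 0 <= s -> s <= s' -> euclid (s, q) <= euclid (s', q).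
  by move=> s0 ss; exact: euclid_mono.
have hs s : a <= s <= b -> r <= euclid (s, q) <= S.
  move=> /andP[s1 s2]; rewrite mono// (le_trans _ bS)// mono// (le_trans a0)//.
have b2 : euclid (b, q) <= 2 * r.
  rewrite -(@ler_pXn2r _ 2) ?nnegrE ?euclid_ge0 ?mulr_ge0 ?(ltW r0)//
    exprMn !euclid_sqr /=.
  have := euclid_sqr (a, q); rewrite -/r /=; have -> : b = a + h by rewrite /h;
    ring.
  nra.
have [Cg Lg] := tempered_C11_on lambda gamma q a b r S l0 g0 r0 hs.
have eg := linear_interpolation _ _ _ _ _ t Cg _ ab t01.
have ha : a <= a <= b by lra.
have hb : a <= b <= b by lra.
have := @interpolation_mul R t (sym_diff u x (a, q)) (sym_diff u x (b,
  q)) (sym_diff u x (m, q))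
  (tempered lambda gamma (a, q)) (tempered lambda gamma (b,
    q)) (tempered lambda gamma (m, q))
  (4 * M * h ^+ 2) (B * (r `^ (- gamma) * r^-1 ^+ 2) * h ^+ 2) (16 * M * r ^+ 2)
    (r `^ (- gamma))
  (8 * M * r * h) (A * (r `^ (- gamma) * r^-1) * h) t01.
have G0 : 0 < r `^ (- gamma) by exact: powR_gt0.
have ri : 0 < r^-1 by rewrite invr_gt0.
have br : b <= 2 * r.
  apply: le_trans b2.
  by rewrite -(@ler_pXn2r _ 2) ?nnegrE ?euclid_ge0 ?(le_trans a0)//
    euclid_sqr /= lerDl sqr_ge0.
have mah s : a <= s <= b -> `|s - m| <= h by move=> ?; rewrite /h ler_norml;
  lra.
have sl s : a <= s <= b -> `|sym_diff u x (s, q) - sym_diff u x (m,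
  q)| <= 8 * M * r * h.
  move=> hs'; apply: (le_trans (sym_diff_lipschitz M (2 * r) u x q s m hu M0 _
    _)); [lra..|].
  rewrite (_ : 4 * M * (2 * r) = 8 * M * r); last by ring.
  by rewrite ler_wpM2l ?mah// !mulr_ge0// ltW.
have gl s : a <= s <= b -> `|tempered lambda gamma (s,
  q) - tempered lambda gamma (m, q)|
    <= A * (r `^ (- gamma) * r^-1) * h.
  move=> hs'; apply: (le_trans (Lg s m hs' am)).
  by rewrite ler_wpM2l ?mah// !mulr_ge0// ltW.
move=> /(_ (sym_diff_interpolation M u x q a b t hu M0 ab t01)).
move=> /(_ (eg _)).
have -> : 4 * M * h ^+ 2 * r `^ (- gamma) +
     16 * M * r ^+ 2 * (B * (r `^ (- gamma) * r^-1 ^+ 2) * h ^+ 2) +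
     8 * M * r * h * (A * (r `^ (- gamma) * r^-1) * h) =
  M * (4 + 16 * B + 8 * A) * (h ^+ 2 * r `^ (- gamma)).
  by field; rewrite gt_eqF.
apply => //; [by rewrite !mulr_ge0// ?sqr_ge0 ltW| | |exact: sl|exact: sl|exact:
  gl|exact: gl].
- apply: (le_trans (sym_diff_bound M u x (m, q) hu M0)).
  have e2 : euclid (m, q) <= 2 * r.
    by apply: le_trans b2; apply: mono; lra.
  have e3 : euclid (m, q) ^+ 2 <= (2 * r) ^+ 2.
    by rewrite ler_pXn2r ?nnegrE ?euclid_ge0 ?mulr_ge0 ?(ltW r0).
  have := ler_wpM2l M0 e3; rewrite exprMn; lra.
- have /andP[k0 k1] := tempered_bound lambda gamma (m, q) l0.
  rewrite ger0_norm// (le_trans k1)// !powRN lef_pV2 ?posrE ?powR_gt0//.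
    apply: ge0_ler_powR; rewrite ?nnegrE ?euclid_ge0 ?(ltW r0)//.
    by case/andP: (hs m am).
  by case/andP: (hs m am) => ? _; exact: lt_le_trans r0 _.
Qed.

(** Interpolation in the second coordinate becomes interpolation in the first for the transposed
    function; this is why the constant of [psi_interpolation] is chosen before [u]. *)
Lemma psi_swap {R : realType} (lambda gamma : R) (u : R * R -> R) (x :
  R * R) (p q : R) :
  psi lambda gamma u x (p, q) =
  psi lambda gamma (fun y => u (y.2, y.1)) (x.2, x.1) (q, p).
Proof.
rewrite /psi /sym_diff /tempered /euclid /= -surjective_pairing [q ^+ 2 +
  _]addrC.
by rewrite -!(addrA (u _)) [X in u _ + X]addrCA.
Qed.

Lemma partials_C11_swap {R : realType} (M : R) (u : R * R -> R) :
  partials_C11 M u -> partials_C11 M (fun y => u (y.2, y.1)).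
Proof. by case. Qed.

(** The corner [(a, b)] is the one nearest to the origin. Being at distance at least [h], it keeps
    the distance of every point of the cell within a factor 3 of its own. *)
Lemma psi_bilinear {R : realType} (M S lambda gamma : R) : 0 <= M ->
  0 <= lambda -> 0 <= gamma -> 0 <= S ->
  exists2 C : R, 0 <= C & forall (u : R * R -> R) (x : R * R) (a b h t s : R),
    partials_C11 M u -> 0 <= a -> 0 <= b -> 0 < h -> h <= euclid (a, b) ->
    0 <= t <= 1 -> 0 <= s <= 1 -> euclid (a + h, b + h) <= S ->
    `|(1 - t) * ((1 - s) * psi lambda gamma u x (a,
      b) + s * psi lambda gamma u x (a, b + h))
      + t * ((1 - s) * psi lambda gamma u x (a + h,
        b) + s * psi lambda gamma u x (a + h, b + h))
      - psi lambda gamma u x (a + t * h, b + s * h)|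
    <= C * (h ^+ 2 * euclid (a + t * h, b + s * h) `^ (- gamma)).
Proof.
move=> M0 l0 g0 S0; have [C C0 HC] := psi_interpolation M S lambda gamma M0 l0
  g0 S0.
(* The factor 2 counts the two directions; [3 ^ gamma] passes from the nearest corner to the
   interpolation point. *)
exists (C * 2 * 3 `^ gamma); first by rewrite !mulr_ge0 ?powR_ge0.
move=> u x a b h t s hu a0 b0 h0 hr /andP[t0 t1] /andP[s0 s1] bS.
have mono := @euclid_mono R.
set r := euclid (a, b) in hr; have r0 : 0 < r by exact: lt_le_trans hr.
have th : 0 <= t * h <= h by rewrite mulr_ge0 ?(ltW h0)//= ler_piMl// ltW.
have sh : 0 <= s * h <= h by rewrite mulr_ge0 ?(ltW h0)//= ler_piMl// ltW.
set z := (a + t * h, b + s * h).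
have z3 : r <= euclid z <= 3 * r.
  rewrite mono ?lerDl//=; [|by case/andP: th|by case/andP: sh].
  rewrite -(@ler_pXn2r _ 2) ?nnegrE ?euclid_ge0 ?mulr_ge0 ?(ltW r0)//.
  have e := euclid_sqr (a, b); rewrite -/r /= in e.
  have ar : a + t * h <= 2 * r.
    have : a <= r by rewrite -(@ler_pXn2r _ 2) ?nnegrE ?(ltW r0)//
      e lerDl sqr_ge0.
    lra.
  have br : b + s * h <= 2 * r.
    have : b <= r by rewrite -(@ler_pXn2r _ 2) ?nnegrE ?(ltW r0)//
      e lerDr sqr_ge0.
    lra.
  have sq w : 0 <= w -> w <= 2 * r -> w ^+ 2 <= 4 * r ^+ 2.
    move=> w0 w2; rewrite (_ : 4 * r ^+ 2 = (2 * r) ^+ 2); last by ring.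
    by rewrite ler_pXn2r ?nnegrE// mulr_ge0// ltW.
  have := sq _ _ ar; have := sq _ _ br.
  have ez : euclid z ^+ 2 = (a + t * h) ^+ 2 + (b + s * h) ^+ 2 by rewrite
    (euclid_sqr z).
  rewrite ez exprMn => /(_ ltac:(lra)) h1 /(_ ltac:(lra)) h2.
  have := sqr_ge0 r; lra.
have Z : r `^ (- gamma) <= 3 `^ gamma * euclid z `^ (- gamma).
  have e0 : 0 < euclid z by case/andP: z3 => + _; exact: lt_le_trans.
  rewrite !powRN ler_pdivlMr ?powR_gt0// mulrC ler_pdivrMr ?powR_gt0//.
  rewrite -powRM ?(ltW r0)//; apply: ge0_ler_powR;
    rewrite ?nnegrE ?(ltW e0) ?mulr_ge0 ?(ltW r0)//.
  by case/andP: z3.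
have P e : r <= e -> e `^ (- gamma) <= r `^ (- gamma).
  move=> re; rewrite !powRN lef_pV2 ?posrE ?powR_gt0 ?(lt_le_trans r0)//.
  by apply: ge0_ler_powR; rewrite ?nnegrE ?(ltW r0)// (le_trans (ltW r0)).
have [th0 th1] := andP th; have [sh0 sh1] := andP sh.
have ah0 : 0 <= a + h by rewrite addr_ge0// ltW.
have at0 : 0 <= a + t * h by rewrite addr_ge0.
have bs0 : 0 <= b + s * h by rewrite addr_ge0.
have bh0 : 0 <= b + h by rewrite addr_ge0// ltW.
have ath : a + t * h <= a + h by rewrite lerD2l.
have aah : a <= a + h by rewrite lerDl ltW.
have bbh : b <= b + h by rewrite lerDl ltW.
have hP e (re : r <= e) := ler_wpM2l C0 (ler_wpM2l (sqr_ge0 h) (P e re)).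
have tt : 0 <= t <= 1 by rewrite t0.
have ss : 0 <= s <= 1 by rewrite s0.
have L q : b <= q <= b + h -> `|(1 - t) * psi lambda gamma u x (a,
  q) + t * psi lambda gamma u x (a + h, q)
    - psi lambda gamma u x (a + t * h, q)| <= C * (h ^+ 2 * r `^ (- gamma)).
  move=> /andP[q1 q2].
  have q0 : 0 <= q by exact: le_trans q1.
  have rq : r <= euclid (a, q) by exact: mono.
  have := HC u x q a (a + h) t hu a0 _ _ tt.
  rewrite (_ : a + h - a = h); last by ring.
  rewrite (_ : (1 - t) * a + t * (a + h) = a + t * h); last by ring.
  move=> H; apply: (le_trans (H _ _ _ _ _)); [by []|by []|exact:
    lt_le_trans rq|exact: le_trans rq| |].
    by apply: le_trans bS; exact: mono.
  exact: hP.
have L2 : `|(1 - s) * psi lambda gamma u x (a + t * h,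
  b) + s * psi lambda gamma u x (a + t * h, b + h)
    - psi lambda gamma u x z| <= C * (h ^+ 2 * r `^ (- gamma)).
  have rq : r <= euclid (b, a + t * h).
    by rewrite euclid_swap; apply: mono => //; rewrite lerDl.
  have := HC _ (x.2, x.1) (a + t * h) b (b + h) s (partials_C11_swap _ _ hu) b0
    _ _ ss.
  rewrite (_ : b + h - b = h); last by ring.
  rewrite (_ : (1 - s) * b + s * (b + h) = b + s * h); last by ring.
  rewrite -!psi_swap => H; apply: (le_trans (H _ _ _ _ _));
    [by []|by []|exact: lt_le_trans rq|exact: le_trans rq| |].
    by apply: le_trans bS; rewrite euclid_swap; exact: mono.
  exact: hP.
have L0 : _ := L b _; have L1 : _ := L (b + h) _;
  rewrite ?bbh ?lexx /= in L0 L1.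
have {}L0 := L0 isT; have {}L1 := L1 isT.
set E := C * _ in L L0 L1 L2.
apply: (@le_trans _ _ (2 * E)); last first.
  rewrite /E (_ : C * 2 * _ * _ = 2 * (C * (h ^+ 2 * (3 `^ gamma * euclid z `^
    (- gamma))))); last by ring.
  exact: (ler_wpM2l (ler0n R 2) (ler_wpM2l C0 (ler_wpM2l (sqr_ge0 h) Z))).
move: L0 L1 L2; set p00 := psi _ _ _ _ (a, b); set p01 := psi _ _ _ _ (a,
  b + h).
set p10 := psi _ _ _ _ (a + h, b); set p11 := psi _ _ _ _ (a + h, b + h).
set p0 := psi _ _ _ _ (a + t * h, b); set p1 := psi _ _ _ _ (a + t * h, b + h).
move=> L0 L1 L2.
(* A convex combination of the horizontal errors on the lower and upper edges, plus the vertical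
   error on the line through the point. *)
have -> : (1 - t) * ((1 - s) * p00 + s * p01) + t * ((1 - s) * p10 + s * p11) -
  psi lambda gamma u x z =
  (1 - s) * ((1 - t) * p00 + t * p10 - p0) + s * ((1 - t) * p01 + t * p11 - p1)
  + ((1 - s) * p0 + s * p1 - psi lambda gamma u x z) by ring.
rewrite (_ : 2 * E = E + E); last by ring.
apply: (le_trans (ler_normD _ _)); apply: (lerD _ L2).
apply: (le_trans (ler_normD _ _)); rewrite !normrM (ger0_norm s0) (@ger0_norm _
  (1 - s)) ?subr_ge0//.
rewrite (_ : E = (1 - s) * E + s * E); last by ring.
have s1' : 0 <= 1 - s by rewrite subr_ge0.
exact: (lerD (ler_wpM2l s1' L0) (ler_wpM2l s0 L1)).
Qed.

(** * Hat functions and interpolation on the grid *)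

Lemma sum_hat {R : realType} (h s : R) (N k : nat) (v : nat -> R) :
  0 < h -> (k < N)%N -> k%:R * h <= s <= k.+1%:R * h ->
  let t := (s - k%:R * h) / h in
  \sum_(i < N.+1) v i * hat h i s = (1 - t) * v k + t * v k.+1.
Proof.
move=> h0 kN /andP[ks sk] t.
have tE : s = k%:R * h + t * h by rewrite /t divfK ?gt_eqF//; ring.
have t0 : 0 <= t by rewrite divr_ge0 ?subr_ge0// ltW.
have t1 : t <= 1 by rewrite ler_pdivrMr// mul1r;
  rewrite -natr1 mulrDl mul1r in sk; lra.
have hh i : `|s - i%:R * h| / h = `|k%:R - i%:R + t|.
  rewrite tE (_ : _ - _ = (k%:R - i%:R + t) * h); last by ring.
  by rewrite normrM (gtr0_norm h0) mulfK// gt_eqF.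
have k1 : (k < N.+1)%N by rewrite ltnS ltnW.
rewrite (bigD1 (Ordinal k1)) //= (bigD1 (Ordinal (kN : k.+1 < N.+1)%N)) /=;
  last first.
  by rewrite -val_eqE /= gtn_eqF.
rewrite [X in _ + (_ + X)]big1 ?addr0.
  rewrite /hat !hh -natr1 subrr add0r (ger0_norm t0).
  rewrite (_ : k%:R - (k%:R + 1) + t = - (1 - t)); last by ring.
  rewrite normrN ger0_norm ?subr_ge0// (_ : 1 - (1 - t) = t); last by ring.
  by rewrite !(@max_r _ _ 0) ?subr_ge0//; ring.
move=> i /andP[]; rewrite -!val_eqE /= => ik ik1.
rewrite /hat hh max_l ?mulr0// subr_le0.
case: (ltngtP i k) => [ik2|ik2|]; last by move=> e; rewrite e eqxx in ik.
  have : (i.+1%:R : R) <= k%:R by rewrite ler_nat.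
  by rewrite -natr1 => H; rewrite ger0_norm; lra.
have : (k.+2%:R : R) <= i%:R by rewrite ler_nat ltn_neqAle eq_sym ik1.
by rewrite -2!natr1 => H; rewrite ler0_norm; lra.
Qed.

(** Taking the least [k] assigns grid lines to the cell on their left. The last clause ensures that
    a point outside [0, h]^2 lies in a cell whose lower corner is at distance at least [h] from the
    origin. *)
Lemma grid_cell {R : realType} (h s : R) (N : nat) : 0 < h -> (0 < N)%N ->
  0 <= s <= N%:R * h ->
  exists k, [/\ (k < N)%N, k%:R * h <= s <= k.+1%:R * h & h < s -> h <=
    k%:R * h].
Proof.
move=> h0 N0 /andP[s0 sN].
have ex : exists k, (fun k : nat => s <= k.+1%:R * h) k by exists N.-1;
  rewrite prednK.
case: (ex_minnP ex) => k sk kmin; exists k; split.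
- by rewrite -(prednK N0) ltnS; apply: kmin; rewrite prednK.
- rewrite sk andbT; case: k {sk} kmin => [|k] kmin; first by rewrite mul0r.
  by rewrite leNgt; apply/negP => /ltW /kmin; rewrite ltnn.
- move=> hs; rewrite ler_peMl ?(ltW h0)// ler1n lt0n; apply/eqP => k0.
  by rewrite k0 mul1r leNgt hs in sk.
Qed.

Lemma mesh_gt0 {R : realType} (l : R) (N : nat) : 0 < l -> (2 <= N)%N ->
  0 < mesh l N.
Proof.
by move=> l0 N2; rewrite /mesh divr_gt0 ?mulr_gt0// ltr0n; apply: leq_trans N2.
Qed.

Lemma mesh_mul {R : realType} (l : R) (N : nat) : (2 <= N)%N ->
  N%:R * mesh l N = 2 * l.
Proof.
move=> N2; rewrite /mesh mulrC divfK// pnatr_eq0; by case: N N2.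
Qed.

Lemma euclid_square {R : realType} (a : R) (z : R * R) : square a z ->
  euclid z <= 2 * a.
Proof.
move=> [/=]; rewrite !in_itv /= => /andP[z1 z2] /andP[z3 z4].
have /andP[_ /le_trans ->//] := sup_norm_euclid z.
by rewrite ler_pM2l// /sup_norm ge_max !ger0_norm// z2 z4.
Qed.

(* The node (0, 0), excluded from the scheme, is harmless:
   [psi] vanishes there. *)
Lemma psi_grid_interpolation {R : realType} (M l lambda gamma : R) : 0 <= M ->
  0 <= lambda -> 0 <= gamma -> 0 < l ->
  exists2 C : R, 0 <= C & forall (u : R * R -> R) (x z : R * R) (N : nat) (h :
    R),
    h = mesh l N ->
    partials_C11 M u -> (2 <= N)%N -> (square (2 * l) `\` square h) z ->
    `|\sum_(i < N.+1) \sum_(j < N.+1) psi lambda gamma u x (i%:R * h, j%:R * h)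
         * (hat h i z.1 * hat h j z.2) - psi lambda gamma u x z|
    <= C * (h ^+ 2 * euclid z `^ (- gamma)).
Proof.
move=> M0 l0 g0 ll0.
have S0 : 0 <= 2 * (2 * l) by rewrite !mulr_ge0// ltW.
have [C C0 HC] := psi_bilinear M (2 * (2 * l)) lambda gamma M0 l0 g0 S0.
exists C => // u x z N h hE hu N2 [zL zh].
have h0 : 0 < h by rewrite hE mesh_gt0.
have N0 : (0 < N)%N by exact: leq_trans N2.
have [z1 z2] : 0 <= z.1 <= N%:R * h /\ 0 <= z.2 <= N%:R * h.
  by rewrite hE (mesh_mul l N N2); case: zL => /=; rewrite !in_itv.
have [k [kN kz kh]] := grid_cell h z.1 N h0 N0 z1.
have [m [mN mz mh]] := grid_cell h z.2 N h0 N0 z2.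
pose t := (z.1 - k%:R * h) / h; pose s := (z.2 - m%:R * h) / h.
have E1 : z.1 = k%:R * h + t * h by rewrite /t divfK ?gt_eqF//; ring.
have E2 : z.2 = m%:R * h + s * h by rewrite /s divfK ?gt_eqF//; ring.
have k0 : 0 <= k%:R * h by rewrite mulr_ge0// ltW.
have m0 : 0 <= m%:R * h by rewrite mulr_ge0// ltW.
have frac (n : nat) (w : R) : n%:R * h <= w <= n.+1%:R * h -> 0 <=
  (w - n%:R * h) / h <= 1.
  move=> /andP[w1 w2]; rewrite divr_ge0 ?subr_ge0 ?(ltW h0)//= ler_pdivrMr//
    mul1r lerBlDl.
  by rewrite -[X in X <= _]addr0 addr0 (le_trans w2)// -natr1 mulrDl mul1r.
have hr : h <= euclid (k%:R * h, m%:R * h).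
  have /andP[+ _] := sup_norm_euclid (k%:R * h, m%:R * h); apply: le_trans.
  rewrite /sup_norm /= le_max !ger0_norm//.
  have [hz1|hz1] := ltP h z.1; first by rewrite kh.
  have [hz2|hz2] := ltP h z.2; first by rewrite mh ?orbT.
  exfalso; apply: zh; split; rewrite /= in_itv /= ?hz1 ?hz2 andbT.
    by case/andP: z1.
  by case/andP: z2.
have bS : euclid (k%:R * h + h, m%:R * h + h) <= 2 * (2 * l).
  apply: euclid_square; split; rewrite /= in_itv /= -(mesh_mul l N N2) -hE.
    rewrite addr_ge0 ?(ltW h0)//= -[X in _ + X]mul1r -mulrDl natr1 ler_pM2r//.
    by rewrite ler_nat.
  rewrite addr_ge0 ?(ltW h0)//= -[X in _ + X]mul1r -mulrDl natr1 ler_pM2r//.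
  by rewrite ler_nat.
have := HC u x _ _ h t s hu k0 m0 h0 hr (frac _ _ kz) (frac _ _ mz) bS.
rewrite -E1 -E2 -surjective_pairing.
have -> : \sum_(i < N.+1) \sum_(j < N.+1) psi lambda gamma u x (i%:R * h,
  j%:R * h)
         * (hat h i z.1 * hat h j z.2) =
   \sum_(i < N.+1) ((1 - s) * psi lambda gamma u x (i%:R * h, m%:R * h)
      + s * psi lambda gamma u x (i%:R * h, m.+1%:R * h)) * hat h i z.1.
  apply: eq_bigr => i _.
  rewrite -(sum_hat h z.2 N m (fun j => psi lambda gamma u x (i%:R * h,
    j%:R * h)) h0 mN mz).
  by rewrite mulr_suml; apply: eq_bigr => j _; ring.
rewrite (sum_hat h z.1 N k (fun i => (1 - s) * psi lambda gamma u x (i%:R * h,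
  m%:R * h)
      + s * psi lambda gamma u x (i%:R * h, m.+1%:R * h)) h0 kN kz) -/t.
rewrite (_ : k.+1%:R * h = k%:R * h + h); last by rewrite -natr1 mulrDl mul1r.
rewrite (_ : m.+1%:R * h = m%:R * h + h); last by rewrite -natr1 mulrDl mul1r.
exact: id.
Qed.

(** * Consistency *)

Lemma sqr_powR {R : realType} (z : R * R) (p : R) :
  (z.1 ^+ 2 + z.2 ^+ 2) `^ (p / 2) = euclid z `^ p.
Proof.
rewrite -euclid_sqr -powR_mulrn ?euclid_ge0// -powRrM.
by congr (_ `^ _); rewrite mulrC divfK.
Qed.

Lemma sym_diff0 {R : realType} (u : R * R -> R) (x z : R * R) :
  euclid z = 0 -> sym_diff u x z = 0.
Proof.
move=> e0; have := euclid_sqr z; rewrite e0 expr0n /= => /esym /eqP.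
rewrite paddr_eq0 ?sqr_ge0// !sqrf_eq0 => /andP[/eqP h1 /eqP h2].
by rewrite /sym_diff h1 h2 !subr0 !addr0 -surjective_pairing; ring.
Qed.

(** Exponents add away from the origin; at the origin, where [powR] has a default value, both sides
    vanish with [sym_diff]. *)
Lemma psi_weight {R : realType} (lambda gamma beta : R) (u : R * R -> R) (x z :
  R * R) :
  psi lambda gamma u x z * euclid z `^ (gamma - 2 - beta) =
  sym_diff u x z * tempered lambda (2 + beta) z.
Proof.
have [e0|e0] := eqVneq (euclid z) 0; first by rewrite /psi sym_diff0// !mul0r.
rewrite /psi !temperedE -!mulrA; congr (_ * (_ * _)).
rewrite -powRD; last by rewrite e0 implybT.
by congr (_ `^ _); ring.
Qed.

Lemma singular_integrand_bound {R : realType} (M lambda beta : R) (u : R * R ->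
  R) (x z : R * R) :
  partials_C11 M u -> 0 <= M -> 0 <= lambda ->
  `|sym_diff u x z * tempered lambda (2 + beta) z| <=
    4 * M * euclid z `^ (- beta).
Proof.
move=> hu M0 l0; have [e0|e0] := eqVneq (euclid z) 0.
  by rewrite sym_diff0// mul0r normr0 !mulr_ge0 ?powR_ge0.
have -> : euclid z `^ (- beta) = euclid z ^+ 2 * euclid z `^ (- (2 + beta)).
  rewrite -powR_mulrn ?euclid_ge0// -powRD ?e0 ?implybT//.
  by congr (_ `^ _); ring.
have /andP[k0 k1] := tempered_bound lambda (2 + beta) z l0.
rewrite normrM (ger0_norm k0) mulrA ler_pM//.
exact: sym_diff_bound.
Qed.

(** Quadratic vanishing of [sym_diff] weakens the singularity to [|z| ^ -beta], which is integrable
    for [beta < 2]. Since [D] is arbitrary, the bound is uniform in the truncation radius. *)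
Lemma singular_integral_inner {R : realType} (M lambda beta : R) : 0 <= M ->
  0 <= lambda ->
  beta < 2 -> exists2 C : R, 0 <= C &
  forall (u : R * R -> R) (x : R * R) (t : R) (D : set (plane R)),
    partials_C11 M u -> continuous u -> 0 < t -> measurable D ->
    D `<=` [set z | sup_norm z <= t] ->
    (lebesgue2 R).-integrable D (EFin \o (fun z =>
      sym_diff u x z * tempered lambda (2 + beta) z)) /\
    `|\int[lebesgue2 R]_(z in D) (sym_diff u x z * tempered lambda (2 + beta)
      z)|
      <= C * t `^ (2 - beta).
Proof.
move=> M0 l0 b2; have [C C0 HC] := @inner_bound R (- beta) ltac:(lra).
exists (4 * M * C); first by rewrite !mulr_ge0.
move=> u x t D hu cu t0 mD Dt; have [iD bD] := HC t D t0 mD Dt.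
have mT : measurable_fun setT ((fun z => sym_diff u x z * tempered lambda (2 +
  beta) z) : plane R -> R).
  apply: measurable_funM; [exact: measurable_sym_diff|exact:
    measurable_tempered].
have i4 : (lebesgue2 R).-integrable D (EFin \o (fun z =>
  4 * M * euclid z `^ (- beta))).
  exact: (integrableZl mD (4 * M) iD).
have [i1 i2] := Rintegral_dominated _ D _ _ mD (measurable_funTS mT) i4
   (fun z _ => singular_integrand_bound M lambda beta u x z hu M0 l0).
split; first exact: i1.
apply: (le_trans i2); rewrite RintegralZl//.
have M4 : 0 <= 4 * M by rewrite mulr_ge0.
by apply: (le_trans (ler_wpM2l M4 bD)); rewrite mulrA addrC.
Qed.

Lemma measurable_square {R : realType} (a : R) : measurable (square a :
  set (plane R)).
Proof. by apply: measurableX; exact: measurable_itv. Qed.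

Lemma sup_norm_square {R : realType} (a : R) (z : plane R) :
  square a z -> sup_norm z <= a.
Proof.
move=> [/=]; rewrite !in_itv /= => /andP[z1 z2] /andP[z3 z4].
by rewrite /sup_norm ge_max !ger0_norm// z2 z4.
Qed.

Lemma sup_norm_not_square {R : realType} (a : R) (z : plane R) :
  0 <= z.1 -> 0 <= z.2 -> ~ square a z -> a < sup_norm z.
Proof.
move=> z1 z2 ns; rewrite ltNge; apply/negP; rewrite /sup_norm ge_max
  !ger0_norm// => /andP[h1 h2].
by apply: ns; split; rewrite /= in_itv /= ?z1 ?z2.
Qed.

Lemma measurable_hat {R : realType} (h : R) (i : nat) :
  measurable_fun setT (hat h i).
Proof.
apply: measurable_maxr; first exact: measurable_cst.
apply: measurable_funB; first exact: measurable_cst.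
apply: measurable_funM; last exact: measurable_cst.
apply: (measurableT_comp (@normr_measurable R setT)).
by apply: measurable_funB; [exact: measurable_id|exact: measurable_cst].
Qed.

Lemma hat_bound {R : realType} (h : R) (i : nat) (s : R) : 0 < h -> 0 <=
  hat h i s <= 1.
Proof.
by move=> h0; rewrite /hat le_max lexx /= ge_max ler01 /= gerBl divr_ge0// ltW.
Qed.

Lemma Rintegral_sum {d} {T : measurableType d} {R : realType}
    (mu : {measure set T -> \bar R}) (D : set T) (n : nat) (f : nat -> T -> R) :
  measurable D -> (forall i, mu.-integrable D (EFin \o f i)) ->
  mu.-integrable D (EFin \o (fun z => \sum_(i < n) f i z)) /\
  \int[mu]_(z in D) (\sum_(i < n) f i z) = \sum_(i < n) \int[mu]_(z in D) f i z.
Proof.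
move=> mD fi; elim: n => [|n [IH1 IH2]].
  rewrite (_ : (fun z => _) = cst 0); last by apply/funext => z;
    rewrite big_ord0.
  rewrite big_ord0; split; first exact: integrable0.
  by rewrite Rintegral_cst// mul0r.
rewrite (_ : (fun z => _) = fun z => (\sum_(i < n) f i z) + f n z); last first.
  by apply/funext => z; rewrite big_ord_recr.
rewrite big_ord_recr /= -IH2 -RintegralD//; split=> //.
exact: (integrableD mD IH1 (fi n)).
Qed.

Lemma powR_mul {R : realType} (h a b c : R) : 0 < h -> a + b = c ->
  h `^ a * h `^ b = h `^ c.
Proof. by move=> h0 <-; rewrite powRD//; apply/implyP => _; rewrite gt_eqF. Qed.

Lemma quadrature_error {R : realType} (M l lambda beta gamma : R) :
  0 <= M -> 0 <= lambda -> 0 < l -> 0 < beta -> beta < gamma ->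
  exists2 C : R, 0 <= C & forall (u : R * R -> R) (x : R * R) (N : nat) (h : R),
    h = mesh l N -> partials_C11 M u -> continuous u -> (2 <= N)%N ->
    forall S : set (plane R), S = square (2 * l) `\` square h ->
    `|\sum_(i < N.+1) \sum_(j < N.+1) psi lambda gamma u x (i%:R * h, j%:R * h)
        * \int[lebesgue2 R]_(z in S) (hat h i z.1 * hat h j z.2 *
           (z.1 ^+ 2 + z.2 ^+ 2) `^ ((gamma - 2 - beta) / 2))
      - \int[lebesgue2 R]_(z in S) (sym_diff u x z * tempered lambda (2 + beta)
        z)|
    <= C * h `^ (2 - beta).
Proof.
move=> M0 l0 ll0 b0 bg; have g0 : 0 <= gamma by lra.
have [C C0 HC] := psi_grid_interpolation M l lambda gamma M0 l0 g0 ll0.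
have [D D0 HD] := @outer_bound R (- (2 + beta)) ltac:(lra).
exists (C * D); first by rewrite mulr_ge0.
move=> u x N h hE hu cu N2 S SE; have h0 : 0 < h by rewrite hE mesh_gt0.
have ll : 0 < 2 * l by rewrite mulr_gt0.
have mS : measurable S by rewrite SE; apply: measurableD;
  exact: measurable_square.
have Sout : S `<=` [set z | h < sup_norm z].
  rewrite SE => z [[/=]]; rewrite !in_itv /= => /andP[z1 _] /andP[z2 _].
  exact: sup_norm_not_square.
have Sin : S `<=` [set z | sup_norm z <= 2 * l] by rewrite SE =>
  z [/sup_norm_square].
have [K K0 HK] := @inner_bound R (gamma - 2 - beta) ltac:(lra).
have [iW _] := HK (2 * l) S ll mS Sin.
pose W (z : plane R) : R := euclid z `^ (gamma - 2 - beta).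
pose Hij (i j : nat) (z : plane R) : R := hat h i z.1 * hat h j z.2 * W z.
have mW : measurable_fun setT W by exact: measurable_euclid_powR.
have mH i j : measurable_fun setT (Hij i j).
  apply: measurable_funM; last exact: mW.
  apply: measurable_funM.
    exact: (measurableT_comp (measurable_hat h i) measurable_fst).
  exact: (measurableT_comp (measurable_hat h j) measurable_snd).
have iH i j : (lebesgue2 R).-integrable S (EFin \o Hij i j).
  have [] // := Rintegral_dominated _ S _ _ mS (measurable_funTS (mH i j)) iW.
  move=> z _; have /andP[a1 a2] := hat_bound h i z.1 h0;
    have /andP[c1 c2] := hat_bound h j z.2 h0.
  rewrite ger0_norm; last by rewrite !mulr_ge0// powR_ge0.
  by rewrite ler_piMl ?powR_ge0// mulr_ile1.
pose P i j := psi lambda gamma u x (i%:R * h, j%:R * h).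
have iPH i j : (lebesgue2 R).-integrable S (EFin \o (fun z =>
  P i j * Hij i j z)).
  exact: (integrableZl mS (P i j) (iH i j)).
have inner i := Rintegral_sum (lebesgue2 R) S N.+1 _ mS (iPH i).
pose F (z : plane R) : R := \sum_(i < N.+1) \sum_(j < N.+1) P i j * Hij i j z.
have [iF EF] := Rintegral_sum (lebesgue2 R) S N.+1 _ mS (fun i => (inner i).1).
pose T (z : plane R) : R := sym_diff u x z * tempered lambda (2 + beta) z.
have mT : measurable_fun setT T.
  apply: measurable_funM; [exact: measurable_sym_diff|exact:
    measurable_tempered].
have [iK bK] := HD h S h0 mS Sout.
(* Only integrability is wanted here, so [euclid z ^+ 2] is replaced by an upper bound on the whole
   square. *)
have iT : (lebesgue2 R).-integrable S (EFin \o T).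
  have i4 : (lebesgue2 R).-integrable S (EFin \o (fun z =>
    4 * M * (2 * (2 * l)) ^+ 2 * euclid z `^ (- (2 + beta)))).
    exact: (integrableZl mS _ iK).
  have [] // := Rintegral_dominated _ S _ _ mS (measurable_funTS mT) i4.
  rewrite SE => z [zl _]; have /andP[k0 k1] :=
    tempered_bound lambda (2 + beta) z l0.
  rewrite /T normrM (ger0_norm k0) ler_pM//.
  apply: (le_trans (sym_diff_bound M u x z hu M0)).
  rewrite ler_wpM2l ?mulr_ge0// ler_pXn2r ?nnegrE ?euclid_ge0 ?mulr_ge0 ?(ltW
    ll0)//.
  exact: euclid_square.
rewrite [X in `|X - _|](_ : _ = \int[lebesgue2 R]_(z in S) F z); last first.
  rewrite /F EF; apply: eq_bigr => i _; rewrite (inner i).2.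
  apply: eq_bigr => j _; rewrite (RintegralZl (P i j) mS (iH i j));
    congr (_ * _).
  by apply: eq_Rintegral => z _; rewrite sqr_powR.
rewrite -RintegralB//.
have iC : (lebesgue2 R).-integrable S (EFin \o (fun z =>
  C * h ^+ 2 * euclid z `^ (- (2 + beta)))).
  exact: (integrableZl mS _ iK).
have bnd z : S z -> `|F z - T z| <= C * h ^+ 2 * euclid z `^ (- (2 + beta)).
  move=> Sz; have e0 : 0 < euclid z.
    have := Sout z Sz; have /andP[s1 _] := sup_norm_euclid z => /= s2.
    exact: lt_le_trans (lt_trans h0 s2) s1.
  have -> : F z - T z = (\sum_(i < N.+1) \sum_(j < N.+1) P i j * (hat h i z.1 *
    hat h j z.2)
      - psi lambda gamma u x z) * W z.
    rewrite mulrBl psi_weight; congr (_ - _).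
    rewrite mulr_suml; apply: eq_bigr => i _; rewrite mulr_suml;
      apply: eq_bigr => j _.
    by rewrite /Hij !mulrA.
  rewrite normrM (ger0_norm (powR_ge0 _ _)).
  have Sz' := Sz; rewrite SE in Sz'.
  apply: (le_trans (ler_wpM2r (powR_ge0 _ _) (HC u x z N h hE hu N2 Sz'))).
  have Ew : euclid z `^ (- gamma) * W z = euclid z `^ (- (2 + beta)).
    by apply: powR_mul => //; ring.
  by rewrite -!mulrA Ew.
have mFT : measurable_fun S (fun z => F z - T z).
  apply: measurable_funB; last exact: measurable_funTS.
  by have /measurable_EFinP := measurable_int _ iF.
have [_ bd] := Rintegral_dominated (lebesgue2 R) S (fun z =>
  F z - T z) _ mS mFT iC bnd.
apply: (le_trans bd); rewrite RintegralZl//.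
have Ch : 0 <= C * h ^+ 2 by rewrite mulr_ge0 ?sqr_ge0.
apply: (le_trans (ler_wpM2l Ch bK)).
rewrite -powR_mulrn ?(ltW h0)// le_eqVlt; apply/orP; left; apply/eqP.
by rewrite -(powR_mul h 2 (- (2 + beta) + 2) (2 - beta))//; ring.
Qed.

Lemma near_cell_bound {R : realType} (M lambda beta gamma : R) :
  0 <= M -> 0 <= lambda -> beta < gamma -> 0 <= gamma ->
  exists2 C : R, 0 <= C & forall (u : R * R -> R) (x : R * R) (h : R),
    partials_C11 M u -> 0 < h ->
    `|k_gamma gamma / 4 * G00 beta gamma h *
      (psi lambda gamma u x (h, 0) + psi lambda gamma u x (0,
        h) + psi lambda gamma u x (h, h))|
    <= C * h `^ (2 - beta).
Proof.
move=> M0 l0 bg g0; have [K K0 HK] := @inner_bound R (gamma - 2 - beta)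
  ltac:(lra).
(* At the three nodes [sym_diff] is at most 4 M (2 h)^2 = 16 M h^2, and [k_gamma gamma / 4 <= 1 / 3]
   compensates the number of nodes. *)
exists (K * (16 * M)); first by rewrite !mulr_ge0.
move=> u x h hu h0.
have [iW bW] := HK h (square h) h0 (measurable_square h) (@sup_norm_square R h).
have G : 0 <= G00 beta gamma h <= K * h `^ (gamma - beta).
  rewrite /G00 Rintegral_ge0 /=; last by move=> z _; exact: powR_ge0.
  rewrite (_ : gamma - beta = gamma - 2 - beta + 2); last by ring.
  apply: le_trans bW; rewrite le_eqVlt; apply/orP; left; apply/eqP.
  by apply: eq_Rintegral => z _; exact: sqr_powR.
have hpsi z : square h z -> h <= euclid z -> `|psi lambda gamma u x z| <=
  16 * M * (h ^+ 2 * h `^ (- gamma)).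
  move=> zh hz; have e2 := euclid_square h z zh.
  have /andP[k0 k1] := tempered_bound lambda gamma z l0.
  rewrite /psi normrM (ger0_norm k0) mulrA ler_pM//.
    apply: (le_trans (sym_diff_bound M u x z hu M0)).
    have e3 : euclid z ^+ 2 <= (2 * h) ^+ 2.
      by rewrite ler_pXn2r ?nnegrE ?euclid_ge0 ?mulr_ge0 ?(ltW h0).
    have := ler_wpM2l M0 e3; rewrite exprMn; lra.
  apply: (le_trans k1); rewrite !powRN lef_pV2 ?posrE ?powR_gt0 ?(lt_le_trans
    h0)//.
  by apply: ge0_ler_powR; rewrite ?nnegrE ?(ltW h0) ?euclid_ge0.
have sq (a b : R) : 0 <= a <= h -> 0 <= b <= h -> square h (a, b).
  by move=> ha hb; split; rewrite /= in_itv.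
have hh : 0 <= h <= h by rewrite lexx ltW.
have h00 : 0 <= (0 : R) <= h by rewrite lexx ltW.
have sup z : h <= sup_norm z -> h <= euclid z.
  by move=> /le_trans; apply; have /andP[] := sup_norm_euclid z.
have nh : `|h| = h by rewrite ger0_norm// ltW.
have p1 := hpsi (h, 0) (sq _ _ hh h00) (sup (h, 0) _).
have p2 := hpsi (0, h) (sq _ _ h00 hh) (sup (0, h) _).
have p3 := hpsi (h, h) (sq _ _ hh hh) (sup (h, h) _).
rewrite /sup_norm /= nh ?le_max ?lexx ?orbT in p1 p2 p3.
have {}p1 := p1 isT; have {}p2 := p2 isT; have {}p3 := p3 isT.
have kg : 0 <= k_gamma gamma / 4 <= 3^-1 by rewrite /k_gamma; case: ifP => _;
  lra.
rewrite normrM; have [G0 G1] := andP G; have [kg0 kg1] := andP kg.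
rewrite (ger0_norm (mulr_ge0 kg0 G0)).
set q := h ^+ 2 * _ in p1 p2 p3.
have q0 : 0 <= q by rewrite mulr_ge0 ?sqr_ge0 ?powR_ge0.
apply: (@le_trans _ _ (3^-1 * (K * h `^ (gamma - beta)) * (3 * (16 * M * q)))).
  apply: ler_pM; [exact: mulr_ge0|exact: normr_ge0|exact:
    (ler_pM kg0 G0 kg1 G1)|].
  apply: (le_trans (ler_normD _ _)).
  apply: (le_trans (lerD (le_trans (ler_normD _ _) (lerD p1 p2)) p3)); lra.
rewrite /q -powR_mulrn ?(ltW h0)// (powR_mul h 2 (- gamma) (2 - gamma))//.
rewrite -(powR_mul h (gamma - beta) (2 - gamma) (2 - beta))//; last by ring.
rewrite le_eqVlt; apply/orP; left; apply/eqP. by field.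
Qed.

Lemma sum_near_cell {R : realType} (N : nat) (v : nat -> nat -> R) : (2 <=
  N)%N ->
  \sum_(i < N.+1) \sum_(j < N.+1) ((i : nat, j : nat) \in [:: (1, 0); (0, 1);
    (1, 1)]%N)%:R * v i j
  = v 1%N 0%N + v 0%N 1%N + v 1%N 1%N.
Proof.
case: N => [|[|N]] // _; rewrite big_ord_recl [X in _ + X]big_ord_recl.
rewrite [X in _ + (_ + X)]big1 ?addr0; last first.
  by move=> i _; rewrite big1// => j _; rewrite !inE /= mul0r.
rewrite !big_ord_recl /= !big1; [|by move=> j _; rewrite mul0r..].
by rewrite /bump /=; ring.
Qed.

(** Moving the exponential and the power from [scaled_kappa] to [sym_diff] produces [psi]. The two
    summands of [kappa] then separate into the interpolated integral and the trapezoidal term of the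
    first cell. *)
Lemma scheme_sum {R : realType} (beta gamma lambda l : R) (N : nat)
    (u : R * R -> R) (x : R * R) : (2 <= N)%N ->
  let h := mesh l N in let P := psi lambda gamma u x in
  \sum_(i < N.+1) \sum_(j < N.+1 | (i != 0%N :> nat) || (j != 0%N :> nat))
     scaled_kappa beta gamma lambda l N i j * sym_diff u x (i%:R * h,
       j%:R * h) =
  \sum_(i < N.+1) \sum_(j < N.+1) P (i%:R * h, j%:R * h) *
     \int[lebesgue2 R]_(z in square (2 * l) `\` square h) (hat h i z.1 * hat h j
       z.2 *
           (z.1 ^+ 2 + z.2 ^+ 2) `^ ((gamma - 2 - beta) / 2))
  + k_gamma gamma / 4 * G00 beta gamma h * (P (h, 0) + P (0, h) + P (h, h)).
Proof.
move=> N2 h P.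
pose c := k_gamma gamma / 4 * G00 beta gamma h.
have := sum_near_cell N (fun i j => c * P (i%:R * h, j%:R * h)) N2.
rewrite !mul0r !mul1r -!mulrDr -/c => <-.
rewrite -big_split /=; apply: eq_bigr => i _.
rewrite big_mkcond -big_split /=; apply: eq_bigr => j _.
case: ifPn => [_|].
  rewrite /scaled_kappa /kappa -/h /P /psi /tempered /c.
  set I := Rintegral _ _ _; set b := (_%:R); set k := _^-1;
    set s := sym_diff _ _ _.
  by rewrite mulrDl mulrDl; congr (_ + _); ring.
rewrite negb_or !negbK => /andP[/eqP -> /eqP ->].
rewrite /P /psi sym_diff0 ?mul0r ?mulr0 ?addr0//.
by rewrite /euclid /= expr0n /= addr0 sqrtr0.
Qed.

Lemma sym_diff_far {R : realType} (l : R) (u : R * R -> R) (x z : R * R) :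
  (forall y, ~ Omega l y -> u y = 0) -> Omega l x -> 0 <= z.1 -> 0 <= z.2 ->
  2 * l < z.1 \/ 2 * l < z.2 -> sym_diff u x z = 4 * u x.
Proof.
move=> u0 [] /=; rewrite !in_itv /= => /andP[a1 a2] /andP[b1 b2] z1 z2 zl.
have out y1 y2 : (y1 <= - l \/ l <= y1) \/ (y2 <= - l \/ l <= y2) -> u (y1,
  y2) = 0.
  move=> H; apply: u0 => -[] /=; rewrite !in_itv /= =>
    /andP[w1 w2] /andP[w3 w4].
  case: H => -[H|H].
  - by move: (lt_le_trans w1 H); rewrite ltxx.
  - by move: (lt_le_trans w2 H); rewrite ltxx.
  - by move: (lt_le_trans w3 H); rewrite ltxx.
  - by move: (lt_le_trans w4 H); rewrite ltxx.
rewrite /sym_diff !out ?addr0 ?subr0//; case: zl => zl.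
- by left; left; lra.
- by right; left; lra.
- by left; right; lra.
- by right; left; lra.
- by left; left; lra.
- by right; right; lra.
- by left; right; lra.
- by right; right; lra.
Qed.

Lemma regroup_error {R : realType} (S c i2 i3 G a b d : R) :
  `|S - i2| <= a -> `|c| <= b -> `|i3| <= d ->
  `|G + (i2 + i3) - (S + c + G)| <= d + a + b.
Proof. rewrite !ler_norml; lra. Qed.

(** The constant depends on [u] only through [M]. The bound [B] serves integrability alone and does
    not enter the estimate, and neither does [eps]. *)
Lemma consistency {R : realType} (M l lambda beta gamma : R) :
  0 <= M -> 0 <= lambda -> 0 < l -> 0 < beta < 2 -> beta < gamma ->
  exists2 C : R, 0 <= C & forall (u : R * R -> R) (B : R) (x : R * R) (N :
    nat) (eps : R),
    partials_C11 M u -> continuous u -> (forall y, `|u y| <= B) ->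
    (forall y, ~ Omega l y -> u y = 0) -> Omega l x -> (2 <= N)%N ->
    0 < eps < mesh l N ->
    `|truncated_integral beta lambda u x eps
      - (\sum_(i < N.+1) \sum_(j < N.+1 | (i != 0%N :> nat) || (j != 0%N :>
        nat))
           scaled_kappa beta gamma lambda l N i j
           * sym_diff u x (i%:R * mesh l N, j%:R * mesh l N)
         + 4 * u x * Ginf beta lambda l)|
    <= C * mesh l N `^ (2 - beta).
Proof.
move=> M0 l0 ll0 /andP[b0 b2] bg; have g0 : 0 <= gamma by lra.
have [C1 C10 H1] := quadrature_error M l lambda beta gamma M0 l0 ll0 b0 bg.
have [C2 C20 H2] := near_cell_bound M lambda beta gamma M0 l0 bg g0.
have [C3 C30 H3] := singular_integral_inner M lambda beta M0 l0 b2.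
exists (C3 + C1 + C2); first by rewrite !addr_ge0.
move=> u B x N eps hu cu uB u0 Ox N2 /andP[e0 eh].
set h := mesh l N in eh *; have h0 : 0 < h by exact: mesh_gt0.
have hl : h <= 2 * l.
  by rewrite /h /mesh ler_pdivrMr ?ltr0n ?(leq_trans _ N2)//
    ler_peMr ?mulr_ge0 ?(ltW ll0)// ler1n (leq_trans _ N2).
pose T (z : plane R) : R := sym_diff u x z * tempered lambda (2 + beta) z.
have [iT ->] := truncated_integral_quadrant beta lambda B eps u x b0 l0 cu uB
  e0.
pose A1 : set (plane R) := (`[0, +oo[ `*` `[0, +oo[) `\` square (2 * l).
pose A2 : set (plane R) := square (2 * l) `\` square h.
pose A3 : set (plane R) := [set z | eps < euclid z] `&` square h.
have mA1 : measurable A1.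
  by apply: measurableD; [exact: measurable_quadrant|exact: measurable_square].
have mA2 : measurable A2 by apply: measurableD; exact: measurable_square.
have mA3 : measurable A3.
  by apply: measurableI; [exact: measurable_euclid_gt|exact: measurable_square].
have sqQ a : square a `<=` @quadrant R.
  move=> z [] /=; rewrite !in_itv /= => /andP[z1 _] /andP[z2 _].
  by split; rewrite /= in_itv /= andbT.
have sqh : square h `<=` square (2 * l).
  move=> z [] /=; rewrite !in_itv /= => /andP[z1 z2] /andP[z3 z4].
  by split; rewrite /= in_itv /= ?z1 ?z3 (le_trans _ hl).
have epos (t : R) z : eps < t -> t < sup_norm z -> eps < euclid z.
  move=> et tz; have /andP[s1 _] := sup_norm_euclid z.
  exact: lt_le_trans (lt_trans et tz) s1.
have qpos (z : plane R) : quadrant z -> 0 <= z.1 /\ 0 <= z.2.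
  by move=> [] /=; rewrite !in_itv /= !andbT.
(* As [eps < h], the truncation removes points of the first cell only. *)
have DE : [set z | eps < euclid z] `&` quadrant = A1 `|` (A2 `|` A3).
  apply/seteqP; split => z.
    move=> [ez qz]; have [zl|zl] := pselect (square (2 * l) z); last by left.
    right; have [zh|zh] := pselect (square h z); last by left.
    by right.
  move=> [[qz nz]|[[zl nz]|[ez zh]]]; split => //.
  - have [z1 z2] := qpos z qz.
    exact: (epos _ _ (lt_le_trans eh hl) (sup_norm_not_square _ _ z1 z2 nz)).
  - have [z1 z2] := qpos z (sqQ _ _ zl).
    exact: (epos _ _ eh (sup_norm_not_square _ _ z1 z2 nz)).
  - exact: sqQ zl.
  - exact: sqQ zh.
rewrite DE in iT *.
have mA23 : measurable (A2 `|` A3) by exact: measurableU.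
have iT23 : (lebesgue2 R).-integrable (A2 `|` A3) (EFin \o T).
  by apply: integrableS iT; [exact: measurableU|exact: mA23|exact: subsetUr].
have d1 : [disjoint A1 & A2 `|` A3].
  apply/disj_setPS => z [[_ n1] [[z1 _]|[_ z1]]]; first exact: n1.
  exact/n1/sqh.
have d2 : [disjoint A2 & A3] by apply/disj_setPS => z [[_ n1] [_ /n1]].
rewrite (Rintegral_setU mA1 mA23 iT d1) (Rintegral_setU mA2 mA3 iT23 d2).
have -> : \int[lebesgue2 R]_(z in A1) T z = 4 * u x * Ginf beta lambda l.
  have [K K0 HK] := @outer_bound R (- (2 + beta)) ltac:(lra).
  have A1out : A1 `<=` [set z | 2 * l < sup_norm z].
    by move=> z [qz nz]; have [z1 z2] := qpos z qz; exact: sup_norm_not_square.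
  have ll : 0 < 2 * l by rewrite mulr_gt0.
  have [iK _] := HK (2 * l) A1 ll mA1 A1out.
  have [iG _] := Rintegral_dominated (lebesgue2 R) A1 _ _ mA1
    (measurable_funTS (measurable_tempered lambda (2 + beta))) iK
    (fun z _ => let: conj k0 k1 := andP (tempered_bound lambda (2 + beta) z l0)
      in
       eq_ind_r (fun w => w <= _) k1 (ger0_norm k0)).
  rewrite -[RHS](RintegralZl (4 * u x) mA1 iG); apply: eq_Rintegral => z.
  rewrite inE => Az; have [z1 z2] := qpos z Az.1.
  rewrite /T; congr (_ * _).
  have := A1out z Az; rewrite /= /sup_norm lt_max !ger0_norm// => /orP zl.
  exact: (sym_diff_far l).
rewrite (scheme_sum beta gamma lambda l N u x N2) -/h.
have e2 := H1 u x N h erefl hu cu N2 A2 erefl.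
have e3 := H2 u x h hu h0.
have [|_ e4] := H3 u x h A3 hu cu h0 mA3.
  by move=> z [_ /sup_norm_square].
rewrite (_ : (C3 + C1 + C2) * _ = C3 * h `^ (2 - beta) + C1 * h `^ (2 - beta) +
  C2 * h `^ (2 - beta)); last by ring.
exact: (regroup_error _ _ _ _ _ _ _ _ e2 e3 e4).
Qed.

(** * Global bounds for a C^2 function vanishing outside the domain *)

Lemma is_derive_line1 {R : realType} (u : R * R -> R) (s y : R) :
  derivable u (s, y) (1, 0) ->
  is_derive s 1 (fun x => u (x, y)) ('D_((1, 0) : R * R) u (s, y)).
Proof.
have E : (fun h : R => h^-1 *: ((u \o shift (s, y)) (h *: ((1,
  0) : R * R)) - u (s, y))) =
   (fun h : R => h^-1 *: (((fun x => u (x, y)) \o shift s) (h *: (1 :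
     R)) - u (s, y))).
  apply/funext => h /=; congr (_ *: (u _ - _)).
  by congr pair; rewrite /= ?scaler0 ?add0r.
by move=> d; apply: DeriveDef; rewrite ?/derivable ?/derive -E.
Qed.

Lemma is_derive_line2 {R : realType} (u : R * R -> R) (s y : R) :
  derivable u (y, s) (0, 1) ->
  is_derive s 1 (fun x => u (y, x)) ('D_((0, 1) : R * R) u (y, s)).
Proof.
have E : (fun h : R => h^-1 *: ((u \o shift (y, s)) (h *: ((0,
  1) : R * R)) - u (y, s))) =
   (fun h : R => h^-1 *: (((fun x => u (y, x)) \o shift s) (h *: (1 :
     R)) - u (y, s))).
  apply/funext => h /=; congr (_ *: (u _ - _)).
  by congr pair; rewrite /= ?scaler0 ?add0r.
by move=> d; apply: DeriveDef; rewrite ?/derivable ?/derive -E.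
Qed.

(** The complement of [K] is open, so [g] is locally constant there. Applying this twice localizes
    the second derivatives. *)
Lemma derive_closed_support {R : realType} (K : set (R * R)) (g : R * R ->
  R) (v : R * R) :
  closed K -> (forall y, ~ K y -> g y = 0) -> forall y, ~ K y -> 'D_v g y = 0.
Proof.
move=> cK g0 y Ky.
have near0 : \near y, cst 0 y = g y.
  have /= := closed_openC cK; rewrite openE => /(_ y Ky);
    apply: filterS => w Kw.
  by rewrite g0.
exact: (@derive_val _ _ _ y v g 0 (near_eq_is_derive near0 (is_derive_cst 0 y
  v))).
Qed.

Lemma compact_support_bounded {R : realType} (K : set (R * R)) (g : R * R ->
  R) :
  compact K -> continuous g -> (forall y, ~ K y -> g y = 0) ->
  exists2 B : R, 0 <= B & forall y, `|g y| <= B.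
Proof.
move=> cK cg g0.
have /compact_bounded [B [_ hB]] : compact (g @` K).
  by apply: continuous_compact => //; exact: continuous_subspaceT.
exists (Num.max 0 B + 1); first by rewrite addr_ge0// le_max lexx.
have lt1 : B < Num.max 0 B + 1 by rewrite ltr_pwDr// le_max lexx orbT.
move=> y; have [Ky|Ky] := pselect (K y).
  by apply: (hB _ lt1); exists y.
by rewrite g0// normr0 addr_ge0// le_max lexx.
Qed.

(** The closed square is compact and carries [u] together with its pure second derivatives, so their
    bounds there are global; [M] is the sum of the two. *)
Lemma C2_regular {R : realType} (l : R) (u : R * R -> R) :
  C2 u -> (forall y, ~ Omega l y -> u y = 0) ->
  exists B M : R, [/\ 0 <= M, forall y, `|u y| <= B & partials_C11 M u].
Proof.
move=> [cu pu p1 p2] u0.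
pose K : set (R * R) := `[- l, l] `*` `[- l, l].
have cK : compact K by apply: compact_setX; exact: segment_compact.
have clK : closed K by apply: compact_closed => //; exact: norm_hausdorff.
have uK y : ~ K y -> u y = 0.
  move=> Ky; apply: u0 => -[] /=; rewrite !in_itv /= =>
    /andP[h1 h2] /andP[h3 h4].
  by apply: Ky; split; rewrite /= in_itv /= !ltW.
have [B B0 hB] := compact_support_bounded K u cK cu uK.
pose v1 : R * R := (1, 0); pose v2 : R * R := (0, 1).
have K1 := derive_closed_support K _ v1 clK (derive_closed_support K u v1 clK
  uK).
have K2 := derive_closed_support K _ v2 clK (derive_closed_support K u v2 clK
  uK).
have [d11 c11] := p1 v1 (or_introl erefl); have [d22 c22] :=
  p2 v2 (or_intror erefl).
have [d1 _] := pu v1 (or_introl erefl); have [d2 _] := pu v2 (or_intror erefl).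
have [M1 M10 h1] := compact_support_bounded K _ cK c11 K1.
have [M2 M20 h2] := compact_support_bounded K _ cK c22 K2.
exists B, (M1 + M2); split => //; first by rewrite addr_ge0.
split=> y.
  exists (fun s => 'D_v1 u (s, y)) => a b; split => [s _|s t hs ht].
    exact: is_derive_line1.
  have D (w : R) : a <= w <= b -> is_derive w 1 (fun s => 'D_v1 u (s,
    y)) ('D_v1 ('D_v1 u) (w, y)).
    by move=> _; apply: is_derive_line1.
  have [c [-> _ _ _]] := mean_value _ _ a b t s D ht hs.
  by rewrite normrM ler_wpM2r// (le_trans (h1 _))// lerDl.
exists (fun s => 'D_v2 u (y, s)) => a b; split => [s _|s t hs ht].
  exact: is_derive_line2.
have D (w : R) : a <= w <= b -> is_derive w 1 (fun s => 'D_v2 u (y,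
  s)) ('D_v2 ('D_v2 u) (y, w)).
  by move=> _; apply: is_derive_line2.
have [c [-> _ _ _]] := mean_value _ _ a b t s D ht hs.
by rewrite normrM ler_wpM2r// (le_trans (h2 _))// lerDr.
Qed.

(** * The scheme as a stencil and its stability *)

(* Unfolding i >= 0 to +-i counts i = 0 twice. *)
Definition half0 {R : realType} (i : nat) : R := if i == 0%N then 2^-1 else 1.

(** Only [i = |p - k|] contributes: through one indicator if [p] and [k] differ, through both if
    they coincide, where [half0] compensates. *)
Lemma fold_sum {R : realType} (N p k : nat) (W : nat -> R) :
  (0 < p < N)%N -> (0 < k < N)%N ->
  \sum_(i < N.+1) half0 i * W i *
     ((p%:Z + i%:Z == k%:Z)%:R + (p%:Z - i%:Z == k%:Z)%:R) = W `|p - k|%N.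
Proof.
move=> /andP[p0 pN] /andP[k0 kN].
have dN : (`|p - k| < N.+1)%N by lia.
rewrite (bigD1 (Ordinal dN)) //= big1 ?addr0; last first.
  move=> i; rewrite -val_eqE /= => ik.
  have -> : (p%:Z + i%:Z == k%:Z) = false by apply/eqP; lia.
  have -> : (p%:Z - i%:Z == k%:Z) = false by apply/eqP; lia.
  by rewrite addr0 mulr0.
have [e|ne] := eqVneq p k.
  have -> : (p%:Z + `|p - k|%N%:Z == k%:Z) by apply/eqP; lia.
  have -> : (p%:Z - `|p - k|%N%:Z == k%:Z) by apply/eqP; lia.
  by rewrite e distnn /half0 eqxx /= mulr1n; field.
have -> : half0 `|p - k|%N = 1 :> R by rewrite /half0 ifF//; apply/eqP;
  move/eqP: ne; lia.
rewrite mul1r; case: (leqP p k) => pk.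
  have -> : (p%:Z + `|p - k|%N%:Z == k%:Z) by apply/eqP; lia.
  have -> : (p%:Z - `|p - k|%N%:Z == k%:Z) = false by apply/eqP; move/eqP: ne;
    lia.
  by rewrite addr0 mulr1.
have -> : (p%:Z + `|p - k|%N%:Z == k%:Z) = false by apply/eqP; lia.
have -> : (p%:Z - `|p - k|%N%:Z == k%:Z) by apply/eqP; lia.
by rewrite add0r mulr1.
Qed.

(** Extension by zero to all integer nodes, matching the exterior condition. As a sum of indicators
    it can be exchanged with the sums over the stencil. *)
Definition grid_ext {R : realType} (N : nat) (V : 'cV[R]_(N.-1 ^ 2)) (p q :
  int) : R :=
  \sum_b V b ord0 * (((p == (grid_index b).1%:Z)%:R) * ((q == (grid_index
    b).2%:Z)%:R)).

Definition stencil {R : realType} (v : int -> int -> R) (p q : int) (i j :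
  nat) : R :=
  v (p + i%:Z) (q + j%:Z) + v (p - i%:Z) (q + j%:Z)
  + v (p + i%:Z) (q - j%:Z) + v (p - i%:Z) (q - j%:Z).

Lemma grid_index_bound (N : nat) (a : 'I_(N.-1 ^ 2)) :
  (0 < (grid_index a).1 < N)%N /\ (0 < (grid_index a).2 < N)%N.
Proof.
have aN : (a < N.-1 * N.-1)%N by rewrite mulnn ltn_ord.
have n0 : (0 < N.-1)%N by have := leq_ltn_trans (leq0n _) aN;
  rewrite muln_gt0 andbb.
have : (a %/ N.-1 < N.-1)%N by rewrite ltn_divLR.
have : (a %% N.-1 < N.-1)%N by rewrite ltn_pmod.
by rewrite /grid_index /=; lia.
Qed.

Lemma grid_index_inj (N : nat) : injective (@grid_index N).
Proof.
move=> a b [e1 e2]; apply/val_inj => /=.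
by rewrite (divn_eq a N.-1) (divn_eq b N.-1) e1 e2.
Qed.

Lemma grid_index_surj (N p q : nat) : (0 < p < N)%N -> (0 < q < N)%N ->
  exists a, @grid_index N a = (p, q).
Proof.
move=> hp hq.
have lt : (p.-1 * N.-1 + q.-1 < N.-1 ^ 2)%N by rewrite -mulnn; nia.
exists (Ordinal lt); rewrite /grid_index /= divnMDl ?modnMDl; last by lia.
by rewrite divn_small ?modn_small; [congr pair; lia|lia..].
Qed.

Lemma grid_extE {R : realType} (N : nat) (V : 'cV[R]_(N.-1 ^ 2)) (a :
  'I_(N.-1 ^ 2)) :
  grid_ext N V (grid_index a).1%:Z (grid_index a).2%:Z = V a ord0.
Proof.
rewrite /grid_ext (bigD1 a) //= !eqxx !mulr1 big1 ?addr0// => b ba.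
case: eqP => [[e1]|]; last by rewrite mul0r mulr0.
case: eqP => [[e2]|]; last by rewrite mulr0 mulr0.
have : grid_index a = grid_index b by rewrite /grid_index e1 e2.
by move/grid_index_inj => ab; rewrite ab eqxx in ba.
Qed.

Lemma grid_ext_out {R : realType} (N : nat) (V : 'cV[R]_(N.-1 ^ 2)) (p q :
  int) :
  (forall a : 'I_(N.-1 ^ 2), ((grid_index a).1%:Z, (grid_index a).2%:Z) != (p,
    q)) ->
  grid_ext N V p q = 0.
Proof.
move=> H; rewrite /grid_ext big1// => b _; have := H b; rewrite xpair_eqE.
rewrite eq_sym [_ == q]eq_sym.
by case: eqP => _; case: eqP => _ //= _; rewrite ?mul0r ?mulr0.
Qed.

Lemma fold_sum2 {R : realType} (N : nat) (W : nat -> nat -> R) (V :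
  'cV[R]_(N.-1 ^ 2))
    (a : 'I_(N.-1 ^ 2)) :
  let p := (grid_index a).1 in let q := (grid_index a).2 in
  \sum_b W `|p - (grid_index b).1|%N `|q - (grid_index b).2|%N * V b ord0 =
  \sum_(i < N.+1) \sum_(j < N.+1)
     half0 i * half0 j * W i j * stencil (grid_ext N V) p%:Z q%:Z i j.
Proof.
move=> p q; have [hp hq] := grid_index_bound N a.
transitivity (\sum_(b : 'I_(N.-1 ^ 2)) \sum_(i < N.+1) \sum_(j < N.+1) half0 i *
  half0 j * W i j *
   (V b ord0 * (((p%:Z + i%:Z == (grid_index b).1%:Z)%:R + (p%:Z - i%:Z ==
     (grid_index b).1%:Z)%:R)
   * ((q%:Z + j%:Z == (grid_index b).2%:Z)%:R + (q%:Z - j%:Z == (grid_index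
     b).2%:Z)%:R)))).
  apply: eq_bigr => b _; have [hp' hq'] := grid_index_bound N b.
  rewrite -(fold_sum N p _ (fun i => W i `|q - (grid_index b).2|%N) hp hp').
  rewrite mulr_suml; apply: eq_bigr => i _.
  rewrite -(fold_sum N q _ (fun j => W i j) hq hq').
  rewrite mulr_sumr !mulr_suml; apply: eq_bigr => j _; ring.
rewrite exchange_big /=; apply: eq_bigr => i _.
rewrite exchange_big /=; apply: eq_bigr => j _.
rewrite -mulr_sumr; congr (_ * _).
rewrite /stencil /grid_ext -!big_split /=; apply: eq_bigr => b _; ring.
Qed.

Lemma stencil00 {R : realType} (v : int -> int -> R) (p q : int) :
  stencil v p q 0%N 0%N = 4 * v p q.
Proof.
rewrite /stencil; have -> : p + 0%N%:Z = p by lia.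
have -> : q + 0%N%:Z = q by lia.
by ring.
Qed.

(** The factors [half0] cancel the multiplicity 2 on the axes, and at the origin 1/4 cancels the
    four coinciding stencil values. What remains is a discrete copy of [sym_diff] plus the tail,
    with nonnegative coefficients. *)
Lemma scheme_action {R : realType} (beta gamma lambda c l : R) (N : nat)
    (V : 'cV[R]_(N.-1 ^ 2)) (a : 'I_(N.-1 ^ 2)) :
  let v := grid_ext N V in
  let p := (grid_index a).1%:Z in let q := (grid_index a).2%:Z in
  (scheme_matrix beta gamma lambda c l N *m V) a ord0 =
  c * (\sum_(i < N.+1) \sum_(j < N.+1 | (i != 0%N :> nat) || (j != 0%N :> nat))
         scaled_kappa beta gamma lambda l N i j * (4 * v p q - stencil v p q i
           j)
       + 4 * v p q * Ginf beta lambda l).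
Proof.
move=> v p q; rewrite !mxE.
under eq_bigr do rewrite mxE.
rewrite (fold_sum2 N (weight beta gamma lambda c l N) V a) -/p -/q -/v.
pose nz (i j : 'I_N.+1) := (i != 0%N :> nat) || (j != 0%N :> nat).
pose ka i j := scaled_kappa beta gamma lambda l N i j.
pose Sg := \sum_(i < N.+1) \sum_(j < N.+1 | nz i j) ka i j.
have E (i j : 'I_N.+1) : half0 i * half0 j * weight beta gamma lambda c l N i j
  * stencil v p q i j =
   (if nz i j then - c * (ka i j * stencil v p q i j) else 0) +
   (if nz i j then 0 else c * (Sg + Ginf beta lambda l) * (4 * v p q)).
  rewrite /nz /weight; case: ifPn => [/andP[/eqP -> /eqP ->]|].
    by rewrite /= stencil00 /half0 eqxx -/Sg; field.
  rewrite negb_and => h; rewrite h addr0 /half0 -/(ka i j).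
  case: eqP h => [->|_]; case: eqP => [->|_] //= _; by field.
rewrite (eq_bigr _ (fun i _ => eq_bigr _ (fun j _ => E i j))).
rewrite (eq_bigr _ (fun i _ => big_split _ _ _ _ _)) big_split /=.
rewrite [X in X + _](_ : _ = - c * \sum_(i < N.+1) \sum_(j < N.+1 | nz i j) ka i
  j * stencil v p q i j); last first.
  by rewrite mulr_sumr; apply: eq_bigr => i _; rewrite mulr_sumr -big_mkcond.
rewrite [X in _ + X](_ : _ = c * (Sg + Ginf beta lambda l) * (4 * v p q));
  last first.
  rewrite (bigD1 ord0)//= (bigD1 ord0)//= /nz /= big1 ?addr0; last first.
    by move=> j; rewrite -val_eqE /= => ->.
  rewrite big1 ?addr0// => i; rewrite -val_eqE /= => i0; rewrite big1// => j _.
  by rewrite i0.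
have -> : \sum_(i < N.+1) \sum_(j < N.+1 | nz i j) ka i j * (4 * v p q - stencil
  v p q i j) =
   Sg * (4 * v p q) - \sum_(i < N.+1) \sum_(j < N.+1 | nz i j) ka i j * stencil
     v p q i j.
  rewrite /Sg mulr_suml -sumrB; apply: eq_bigr => i _.
  rewrite mulr_suml -sumrB; apply: eq_bigr => j _; ring.
by ring.
Qed.

Lemma scaled_kappa_ge0 {R : realType} (beta gamma lambda l : R) (N i j : nat) :
  0 < l -> (2 <= N)%N -> 0 <= scaled_kappa beta gamma lambda l N i j.
Proof.
move=> l0 N2; have h0 := mesh_gt0 l N l0 N2.
rewrite /scaled_kappa divr_ge0 ?mulr_ge0 ?expR_ge0 ?powR_ge0//.
rewrite /kappa addr_ge0//.
  apply: Rintegral_ge0 => z _; rewrite mulr_ge0 ?powR_ge0//.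
  have /andP[a1 _] := hat_bound (mesh l N) i z.1 h0.
  have /andP[a2 _] := hat_bound (mesh l N) j z.2 h0.
  exact: mulr_ge0.
rewrite mulr_ge0//; last by apply: Rintegral_ge0 => z _; exact: powR_ge0.
by rewrite mulr_ge0// divr_ge0// /k_gamma; case: ifP => // _; rewrite divr_ge0.
Qed.

Lemma stability {R : realType} (beta gamma lambda c l : R) (N : nat)
    (V : 'cV[R]_(N.-1 ^ 2)) (tau : R) : 0 < l -> (2 <= N)%N -> 0 < c ->
  0 < Ginf beta lambda l ->
  (forall a, `|(scheme_matrix beta gamma lambda c l N *m V) a ord0| <= tau) ->
  forall a, `|V a ord0| <= tau / (4 * c * Ginf beta lambda l).
Proof.
move=> l0 N2 c0 G0 hV a0.
(* At an index of largest modulus, [4 * v p q - stencil] has the sign of [v p q], so the sum can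
   only reinforce the tail term. *)
have [a _ amax] := @arg_maxP _ _ _ a0 xpredT (fun a => `|V a ord0|) isT.
apply: (le_trans (amax a0 isT)) => {a0}.
(* Stencil points may leave the interior grid; the extension is zero there, so the maximum is
   global. *)
have vmax p q : `|grid_ext N V p q| <= `|V a ord0|.
  have [/existsP[b /eqP[<- <-]]|] := boolP [exists b : 'I_(N.-1 ^ 2),
      ((grid_index b).1%:Z, (grid_index b).2%:Z) == (p, q)].
    by rewrite grid_extE; exact: amax.
  by rewrite negb_exists => /forallP H; rewrite grid_ext_out// normr0.
set p := (grid_index a).1%:Z; set q := (grid_index a).2%:Z;
  set v := grid_ext N V.
rewrite -grid_extE -/p -/q -/v in vmax *.
have := hV a; rewrite scheme_action -/p -/q -/v => hVa.
have vb p' q' : - `|v p q| <= v p' q' <= `|v p q| by rewrite -ler_norml vmax.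
have k0 (i j : nat) := scaled_kappa_ge0 beta gamma lambda l N i j l0 N2.
have cG : 0 < 4 * c * Ginf beta lambda l by rewrite !mulr_gt0.
rewrite ler_pdivlMr//; apply: le_trans hVa.
rewrite normrM (gtr0_norm c0) (_ : `|v p q| * _ = c * (4 * `|v p q| * Ginf beta
  lambda l)); last by ring.
rewrite (ler_pM2l c0); have [va|va] := leP 0 (v p q).
  rewrite (ger0_norm va) in vb *; apply: le_trans (ler_norm _); rewrite lerDr.
  apply: sumr_ge0 => i _; apply: sumr_ge0 => j _; apply: mulr_ge0 => //.
  have /andP[_ h1] := vb (p + i%:Z) (q + j%:Z);
    have /andP[_ h2] := vb (p - i%:Z) (q + j%:Z).
  have /andP[_ h3] := vb (p + i%:Z) (q - j%:Z);
    have /andP[_ h4] := vb (p - i%:Z) (q - j%:Z).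
  by rewrite /stencil; lra.
rewrite (ltr0_norm va) in vb *; rewrite -normrN; apply: le_trans (ler_norm _).
rewrite opprD mulrN mulNr lerDr oppr_ge0.
apply: sumr_le0 => i _; apply: sumr_le0 => j _; apply: mulr_ge0_le0 => //.
have /andP[h1 _] := vb (p + i%:Z) (q + j%:Z); have /andP[h2 _] :=
  vb (p - i%:Z) (q + j%:Z).
have /andP[h3 _] := vb (p + i%:Z) (q - j%:Z); have /andP[h4 _] :=
  vb (p - i%:Z) (q - j%:Z).
by rewrite /stencil; lra.
Qed.

Lemma Ginf_gt0 {R : realType} (beta lambda l : R) : 0 < beta -> 0 <= lambda ->
  0 < l ->
  0 < Ginf beta lambda l.
Proof.
move=> b0 l0 ll0.
pose D : set (plane R) := (`[0, +oo[ `*` `[0, +oo[) `\` square (2 * l).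
(* A unit square inside the domain of integration, on which the integrand is at least the positive
   constant [m] defined below. *)
pose E : set (plane R) := `[2 * l + 1, 2 * l + 2] `*` `[0, 1].
have mD : measurable D.
  by apply: measurableD; [exact: measurable_quadrant|exact: measurable_square].
have mE : measurable E by apply: measurableX; exact: measurable_itv.
have ED : E `<=` D.
  move=> z [] /=; rewrite !in_itv /= => /andP[z1 z2] /andP[z3 z4]; split.
    by split; rewrite /= in_itv /= andbT //; lra.
  by move=> -[] /=; rewrite !in_itv /= => /andP[_ z5] _; lra.
have [K K0 HK] := @outer_bound R (- (2 + beta)) ltac:(lra).
have Dout : D `<=` [set z | 2 * l < sup_norm z].
  move=> z [[/=]]; rewrite !in_itv /= !andbT => z1 z2;
    exact: sup_norm_not_square.
have ll : 0 < 2 * l by rewrite mulr_gt0.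
have [iK _] := HK (2 * l) D ll mD Dout.
have [iG _] := Rintegral_dominated (lebesgue2 R) D _ _ mD
    (measurable_funTS (measurable_tempered lambda (2 + beta))) iK
    (fun z _ => let: conj k0 k1 := andP (tempered_bound lambda (2 + beta) z l0)
      in
       eq_ind_r (fun w => w <= _) k1 (ger0_norm k0)).
pose S := 2 * (2 * l + 2); have S0 : 0 < S by rewrite mulr_gt0// addr_gt0.
pose m := (expR (lambda * S) * S `^ (2 + beta))^-1.
have m0 : 0 < m by rewrite invr_gt0 mulr_gt0 ?expR_gt0 ?powR_gt0.
have mE1 : lebesgue2 R E = 1%E.
  rewrite product_measure1E; [|exact: measurable_itv..].
  have I (a b : R) : b - a = 1 -> (@lebesgue_measure R `[a, b] = 1)%E.
    move=> ab; rewrite lebesgue_measure_itv /= lte_fin ifT; last by lra.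
    by rewrite -EFinB ab.
  rewrite [X in (X * _)%E](_ : _ = 1%E) ?mul1e; last by apply: I; ring.
  by apply: I; ring.
have iGE : (lebesgue2 R).-integrable E (EFin \o tempered lambda (2 + beta)).
  by apply: integrableS iG; [exact: mD|exact: mE|exact: ED].
have DEE : D = E `|` (D `\` E) by rewrite setDUK.
have mDE : measurable (D `\` E) by exact: measurableD.
have -> : Ginf beta lambda l = \int[lebesgue2 R]_(z in D) tempered lambda (2 +
  beta) z by [].
rewrite DEE Rintegral_setU; [|exact: mE|exact: mDE|by rewrite -DEE|];
  last first.
  by apply/disj_setPS => z [? []].
apply: ltr_wpDr.
  apply: Rintegral_ge0 => z _.
  by have /andP[] := tempered_bound lambda (2 + beta) z l0.
apply: (lt_le_trans m0).
have -> : m = \int[lebesgue2 R]_(z in E) m.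
  rewrite Rintegral_cst; last exact: mE.
  by rewrite [X in fine X](_ : _ = 1%E) /= ?mulr1//; exact: mE1.
apply: le_Rintegral; [exact: mE| |exact: iGE|].
  apply/integrableP; split; first exact: measurable_cst.
  rewrite (eq_integral (cst m%:E)); last by move=> z _ /=; rewrite gtr0_norm.
  rewrite integral_cst; last exact: mE.
  by rewrite [X in (_ * X)%E](_ : _ = 1%E) ?mule1 ?ltry//; exact: mE1.
move=> z [] /=; rewrite !in_itv /= => /andP[z1 z2] /andP[z3 z4].
have zS : euclid z <= S.
  have /andP[_ /le_trans] := sup_norm_euclid z; apply; rewrite /S ler_pM2l//.
  by rewrite /sup_norm ge_max !ger0_norm; lra.
have e0 : 0 < euclid z.
  have /andP[+ _] := sup_norm_euclid z; apply: lt_le_trans.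
  by rewrite /sup_norm lt_max ger0_norm; lra.
rewrite /m /tempered lef_pV2 ?posrE ?mulr_gt0 ?expR_gt0 ?powR_gt0//.
apply: ler_pM; rewrite ?expR_ge0 ?powR_ge0//; first by rewrite ler_expR
  ler_wpM2l.
by apply: ge0_ler_powR; rewrite ?nnegrE ?(ltW e0) ?(ltW S0)//; lra.
Qed.

(** The exterior condition makes extension by zero agree with sampling [u]: a node that is not
    interior lies outside the open square. *)
Lemma grid_ext_values {R : realType} (l : R) (N : nat) (u : R * R -> R) (p q :
  int) :
  0 < l -> (2 <= N)%N -> (forall y, ~ Omega l y -> u y = 0) ->
  grid_ext N (grid_values l N u) p q =
  u (- l + p%:~R * mesh l N, - l + q%:~R * mesh l N).
Proof.
move=> l0 N2 u0; have h0 := mesh_gt0 l N l0 N2.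
have [/existsP[a /eqP[<- <-]]|] := boolP [exists a : 'I_(N.-1 ^ 2),
    ((grid_index a).1%:Z, (grid_index a).2%:Z) == (p, q)].
  by rewrite grid_extE mxE.
rewrite negb_exists => /forallP H; rewrite grid_ext_out//.
apply/esym/u0 => -[] /=; rewrite !in_itv /= => /andP[p1 p2] /andP[q1 q2].
have B (r : int) : - l < - l + r%:~R * mesh l N -> - l + r%:~R * mesh l N < l ->
    exists2 n : nat, r = n%:Z & (0 < n < N)%N.
  move=> r1 r2.
  have : 0 < r%:~R * mesh l N by lra.
  rewrite pmulr_lgt0// ltr0z => r0.
  have : r%:~R * mesh l N < N%:R * mesh l N by rewrite (mesh_mul l N N2); lra.
  rewrite ltr_pM2r// -[N%:R]/(N%:Z%:~R) ltr_int => rN.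
  by exists `|r|%N; lia.
have [n pn nN] := B p p1 p2; have [m qm mN] := B q q1 q2.
have [a ea] := grid_index_surj N n m nN mN.
by have := H a; rewrite ea /= pn qm eqxx.
Qed.

(** * Discrete norms, the residual and the error *)

Lemma norm_inf_le {R : realType} (n : nat) (V : 'cV[R]_n) (t : R) :
  0 <= t -> (forall a, `|V a ord0| <= t) -> norm_inf V <= t.
Proof. by move=> t0 h; apply/bigmax_leP; split. Qed.

(** There are at most N^2 entries, and h N = 2 l. *)
Lemma norm2h_le {R : realType} (l t : R) (N : nat) (V : 'cV[R]_(N.-1 ^ 2)) :
  0 < l -> (2 <= N)%N -> 0 <= t ->
  (forall a, `|V a ord0| <= t) -> norm2h (mesh l N) V <= 2 * l * t.
Proof.
move=> l0 N2 t0 h; have h0 := mesh_gt0 l N l0 N2.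
have lt0 : 0 <= 2 * l * t by rewrite !mulr_ge0// ltW.
rewrite /norm2h -(ger0_norm lt0) -sqrtr_sqr; apply: ler_wsqrtr.
have sumV : \sum_(i < N.-1 ^ 2) V i ord0 ^+ 2 <= N%:R ^+ 2 * t ^+ 2.
  apply: (@le_trans _ _ (\sum_(i < N.-1 ^ 2) t ^+ 2)).
    apply: ler_sum => i _; rewrite -real_normK ?num_real//.
    by rewrite ler_pXn2r ?nnegrE.
  rewrite sumr_const card_ord -[leLHS]mulr_natl ler_wpM2r ?sqr_ge0//.
  by rewrite -natrX ler_nat leq_sqr leq_pred.
apply: (le_trans (ler_wpM2l (sqr_ge0 _) sumV)).
by rewrite mulrA -exprMn -exprMn [mesh _ _ * _]mulrC mesh_mul.
Qed.

(** The right-hand side [f] is [c] times the limit of the truncated integrals, which converge by the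
    definition of a solution; the consistency bound holds for all small radii and so passes to the
    limit. *)
Lemma residual_bound {R : realType} (beta gamma lambda l c C B M : R) (N : nat)
    (u f : R * R -> R) :
  0 < l -> (2 <= N)%N -> 0 < c -> continuous u -> (forall y, `|u y| <= B) ->
  partials_C11 M u -> solves_tempered_poisson beta lambda c l u f ->
  (forall (u : R * R -> R) (B : R) (x : R * R) (N : nat) (eps : R),
    partials_C11 M u -> continuous u -> (forall y, `|u y| <= B) ->
    (forall y, ~ Omega l y -> u y = 0) -> Omega l x -> (2 <= N)%N ->
    0 < eps < mesh l N ->
    `|truncated_integral beta lambda u x eps
      - (\sum_(i < N.+1) \sum_(j < N.+1 | (i != 0%N :> nat) || (j != 0%N :>
        nat))
           scaled_kappa beta gamma lambda l N i j
           * sym_diff u x (i%:R * mesh l N, j%:R * mesh l N)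
         + 4 * u x * Ginf beta lambda l)|
    <= C * mesh l N `^ (2 - beta)) ->
  forall a, `|(scheme_matrix beta gamma lambda c l N *m grid_values l N u) a
    ord0
              - grid_values l N f a ord0| <= c * (C * mesh l N `^ (2 - beta)).
Proof.
move=> l0 N2 c0 cu uB hu [sol u0] HC a; have h0 := mesh_gt0 l N l0 N2.
set p := (grid_index a).1%:Z; set q := (grid_index a).2%:Z.
pose x : R * R := (- l + p%:~R * mesh l N, - l + q%:~R * mesh l N).
have [/andP[p0 pN] /andP[q0 qN]] := grid_index_bound N a.
have inter (n : nat) : (0 < n)%N -> (n < N)%N ->
  - l < - l + n%:R * mesh l N < l.
  move=> n0 nN; have n1 : 0 < n%:R * mesh l N by rewrite mulr_gt0// ltr0n.
  have : n%:R * mesh l N < N%:R * mesh l N by rewrite ltr_pM2r// ltr_nat.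
  rewrite (mesh_mul l N N2); lra.
have Ox : Omega l x by split; rewrite /= in_itv /=; exact: inter.
have [cv fx] := sol x Ox.
have fa : grid_values l N f a ord0 = c * lim (truncated_integral beta lambda u x
  @ 0^'+).
  by rewrite mxE -[LHS]fx /tempered_laplacian mulNr opprK.
set K := C * _.
rewrite scheme_action fa -mulrBr normrM (gtr0_norm c0) ler_pM2l// distrC.
set Sm := \sum_(i < _) _.
have E : Sm = \sum_(i < N.+1) \sum_(j < N.+1 | (i != 0%N :> nat) || (j != 0%N :>
  nat))
           scaled_kappa beta gamma lambda l N i j
           * sym_diff u x (i%:R * mesh l N, j%:R * mesh l N).
  apply: eq_bigr => i _; apply: eq_bigr => j _; congr (_ * _).
  rewrite /stencil /sym_diff !grid_ext_values// -/p -/q /x /=.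
  by rewrite !rmorphD !rmorphN /= !mulrDl !mulNr !addrA.
rewrite E grid_ext_values// -/x => {E Sm}.
have near_bound : \forall eps \near 0^'+, `|truncated_integral beta lambda u x
  eps
      - (\sum_(i < N.+1) \sum_(j < N.+1 | (i != 0%N :> nat) || (j != 0%N :>
        nat))
           scaled_kappa beta gamma lambda l N i j
           * sym_diff u x (i%:R * mesh l N, j%:R * mesh l N)
         + 4 * u x * Ginf beta lambda l)| <= K.
  near=> eps; apply: (HC u B) => //; apply/andP; split; near: eps.
    exact: nbhs_right_gt.
  exact: nbhs_right_lt.
set T := (_ + _) in near_bound *.
rewrite ler_distl; apply/andP; split.
  apply: limr_ge => //; apply: filterS near_bound => eps.
  by rewrite ler_distl => /andP[].
apply: limr_le => //; apply: filterS near_bound => eps.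
by rewrite ler_distl => /andP[].
Unshelve. all: by end_near.
Qed.

Theorem theorem3p2 (R : realType) (beta gamma lambda l c : R)
    (u f : R * R -> R)
    (hbeta : 0 < beta < 2) (hgamma : beta < gamma <= 2)
    (hlambda : 0 <= lambda) (hl : 0 < l)
    (hc : is_normalization_constant beta lambda c)
    (huC2 : C2 u)
    (hu : solves_tempered_poisson beta lambda c l u f) :
  exists C : R, 0 < C /\
    forall (N : nat), (2 <= N)%N ->
    forall Uh : 'cV[R]_(N.-1 ^ 2),
      scheme_matrix beta gamma lambda c l N *m Uh = grid_values l N f ->
      norm2h (mesh l N) (grid_values l N u - Uh) <= C * mesh l N `^ (2 - beta) /\
      norm_inf (grid_values l N u - Uh) <= C * mesh l N `^ (2 - beta).
Proof.
have [c0 _ _] := hc; have [b0 b2] := andP hbeta; have [bg _] := andP hgamma.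
have [B [M [M0 uB hM]]] := C2_regular l u huC2 hu.2.
have cu : continuous u by case: huC2.
have [C C0 HC] := consistency M l lambda beta gamma M0 hlambda hl hbeta bg.
have G0 := Ginf_gt0 beta lambda l b0 hlambda hl.
(* Residual constant divided by the stability margin. *)
pose K := c * C / (4 * c * Ginf beta lambda l).
have K0 : 0 <= K by rewrite divr_ge0 ?mulr_ge0// ltW.
(* Covers [K] for the maximum norm and [2 * l * K] for the discrete L2 norm; the added 1 makes it
   positive even if [K = 0]. *)
exists ((1 + 2 * l) * K + 1); split.
  by rewrite ltr_wpDl// mulr_ge0// addr_ge0// mulr_ge0// ltW.
move=> N N2 Uh hUh; set h := mesh l N.
pose t := K * h `^ (2 - beta).
have t0 : 0 <= t by rewrite mulr_ge0 ?powR_ge0.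
have err a : `|(grid_values l N u - Uh) a ord0| <= t.
  rewrite /t /K mulrAC -[c * C * _]mulrA.
  apply: (stability beta gamma lambda c l N _ _ hl N2 c0 G0) => {}a;
    rewrite mulmxBr hUh.
  have := residual_bound beta gamma lambda l c C B M N u f hl N2 c0 cu uB hM hu
    HC a.
  by rewrite [X in _ -> `|X| <= _]mxE [X in _ -> `|_ + X| <= _]mxE.
have lK0 : 0 <= 2 * l * K by rewrite mulr_ge0// mulr_ge0// ltW.
have le1 : t <= ((1 + 2 * l) * K + 1) * h `^ (2 - beta).
  by apply: ler_wpM2r; [exact: powR_ge0|lra].
have le2 : 2 * l * t <= ((1 + 2 * l) * K + 1) * h `^ (2 - beta).
  by rewrite /t mulrA; apply: ler_wpM2r; [exact: powR_ge0|lra].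
split.
  exact: le_trans (norm2h_le l t N _ hl N2 t0 err) le2.
exact: le_trans (norm_inf_le _ _ _ t0 err) le1.
Qed.
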